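(* Let $s\in(\tfrac12,1)$, $N>2s$, $p>\frac{N}{N-2s}$, $q\ge0$ and $R_0>0$. Then, for every $\lambda\le1$, there exists a classical, positive and bounded supersolution of $$(-\Delta)^s u+|\nabla u|^q=\lambda u^p\quad\text{in }\mathbb{R}^N\setminus B_{R_0}.$$
   Context: $N\ge1$ is an integer and $B_R$ denotes the ball in $\mathbb{R}^N$ of radius $R$ centred at $0$. The fractional Laplacian is $(-\Delta)^s u(x)=C_{N,s}\,\mathrm{P.V.}\int_{\mathbb{R}^N}\frac{u(x)-u(y)}{|x-y|^{N+2s}}\,dy$, with $C_{N,s}>0$ a normalization constant. $\mathcal{L}_{2s}$ is the set of functions $u\colon\mathbb{R}^N\to\mathbb{R}$ with $\int_{\mathbb{R}^N}\frac{|u(x)|}{1+|x|^{N+2s}}\,dx<\infty$. A classical supersolution of $(-\Delta)^s u+|\nabla u|^q=\lambda u^p$ in $\mathbb{R}^N\setminus B_{R_0}$ is a function $u\in \mathcal{C}^2(\mathbb{R}^N\setminus B_{R_0})\cap\mathcal{L}_{2s}$ such that $(-\Delta)^s u(x)+|\nabla u(x)|^q\ge\lambda u(x)^p$ for all $x\in\mathbb{R}^N\setminus B_{R_0}$. ''Positive'' means $u>0$ in $\mathbb{R}^N$; ''bounded'' means bounded on $\mathbb{R}^N$. *)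

(* Defs.v *)
From HB Require Import structures.
From mathcomp Require Import all_boot all_order all_algebra.
From mathcomp Require Import all_classical all_reals all_analysis.

Set Implicit Arguments.
Unset Strict Implicit.
Unset Printing Implicit Defensive.

Import Order.TTheory GRing.Theory Num.Theory.
Import numFieldNormedType.Exports.

Local Open Scope classical_set_scope.
Local Open Scope ring_scope.

(* R^n is 'rV[R]_n; its Borel sigma-algebra is presented as the one generated
   by the coordinates. *)
Definition measure_rV_display : measure_display.
Proof. exact: default_measure_display. Qed.

Section measurable_rV.
Context {R : realType}.
Variable n : nat.

Let coors : 'I_n -> 'rV[R]_n -> R := fun i x => x 0 i.

Let rV_set0 : g_sigma_preimage coors set0.
Proof. exact: sigma_algebra0. Qed.

Let rV_setC A : g_sigma_preimage coors A -> g_sigma_preimage coors (~` A).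
Proof. exact: sigma_algebraC. Qed.

Let rV_bigcup (F : _^nat) : (forall i, g_sigma_preimage coors (F i)) ->
  g_sigma_preimage coors (\bigcup_i (F i)).
Proof. exact: sigma_algebra_bigcup. Qed.

HB.instance Definition _ := @isMeasurable.Build measure_rV_display
  'rV[R]_n (g_sigma_preimage coors) rV_set0 rV_setC rV_bigcup.

End measurable_rV.

Lemma measurable_rV_coord (R : realType) n (i : 'I_n) :
  measurable_fun [set: 'rV[R]_n] (fun x : 'rV[R]_n => x 0 i).
Proof.
move=> _ Y mY; rewrite setTI; apply: sub_sigma_algebra => /=.
rewrite -bigcup_seq/=; exists i => /=; first by rewrite mem_index_enum.
by exists Y => //; rewrite setTI.
Qed.

Lemma measurable_fun_rVP d (T : measurableType d) (R : realType) n
    (f : T -> 'rV[R]_n) :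
  measurable_fun [set: T] f <->
  forall i, measurable_fun [set: T] (fun t => f t 0 i).
Proof.
apply: (@iff_trans _ (g_sigma_preimage
    (fun i => (fun x : 'rV[R]_n => x 0 i) \o f) `<=` measurable)).
  rewrite g_sigma_preimage_comp; split=> [mf A [/= C preC <-]|prefS].
    exact: mf.
  by move=> _ A mA; apply: prefS; exists A.
split=> [mf i|mf].
- move=> _ A mA.
  apply: mf; apply: sub_sigma_algebra.
  rewrite -bigcup_seq/=; exists i => /=; first by rewrite mem_index_enum.
  by exists A.
- apply: smallest_sub; first exact: sigma_algebra_measurable.
  rewrite -bigcup_seq/= => A [i _ [B mB <-]].
  exact: mf.
Qed.

Section lebesgue_rV_step.
Context {R : realType}.
Variable n : nat.
Variable m : {sigma_finite_measure set 'rV[R]_n -> \bar R}.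

Definition cons_rV (p : R * 'rV[R]_n) : 'rV[R]_n.+1 :=
  row_mx (const_mx p.1 : 'rV[R]_1) p.2.

Lemma cons_rV0 p : cons_rV p 0 0 = p.1.
Proof.
rewrite /cons_rV (_ : (0 : 'I_n.+1) = lshift n (0 : 'I_1)); last exact: val_inj.
by rewrite (@row_mxEl _ 1 1 n) mxE.
Qed.

Lemma cons_rVS p i : cons_rV p 0 (lift ord0 i) = p.2 0 i.
Proof.
rewrite /cons_rV (_ : lift ord0 i = rshift 1 i); last exact: val_inj.
by rewrite (@row_mxEr _ 1 1 n).
Qed.

Lemma measurable_cons_rV : measurable_fun [set: R * 'rV[R]_n] cons_rV.
Proof.
apply/measurable_fun_rVP => i; case: (unliftP ord0 i) => [j ->|->].
  under eq_fun do rewrite cons_rVS.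
  exact: (measurableT_comp (measurable_rV_coord j)).
under eq_fun do rewrite cons_rV0.
exact: measurable_fst.
Qed.

Definition uncons_rV (x : 'rV[R]_n.+1) : R * 'rV[R]_n :=
  (x 0 0, \row_j x 0 (lift ord0 j)).

Lemma cons_rVK : cancel cons_rV uncons_rV.
Proof.
move=> [a y]; rewrite /uncons_rV cons_rV0; congr pair.
by apply/rowP => j; rewrite mxE cons_rVS.
Qed.

Lemma uncons_rVK : cancel uncons_rV cons_rV.
Proof.
move=> x; apply/rowP => i; case: (unliftP ord0 i) => [j ->|->].
  by rewrite cons_rVS mxE.
by rewrite cons_rV0.
Qed.

Lemma measurable_uncons_rV : measurable_fun [set: 'rV[R]_n.+1] uncons_rV.
Proof.
apply/measurable_fun_pairP; split; first exact: measurable_rV_coord.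
apply/measurable_fun_rVP => i /=.
by under eq_fun do rewrite mxE; exact: measurable_rV_coord.
Qed.

Definition lebesgue_rV_step : set 'rV[R]_n.+1 -> \bar R :=
  pushforward (@lebesgue_measure R \x m)%E cons_rV.

Let step0 : lebesgue_rV_step set0 = 0%E.
Proof. by rewrite /lebesgue_rV_step /pushforward preimage_set0 measure0. Qed.

Let step_ge0 A : (0 <= lebesgue_rV_step A)%E.
Proof. by rewrite /lebesgue_rV_step /pushforward measure_ge0. Qed.

Let step_sigma_additive : semi_sigma_additive lebesgue_rV_step.
Proof.
exact: (@measure_semi_sigma_additive _ _ _
  (measure_function_pushforward__canonical__measure_function_Measure
     (@lebesgue_measure R \x m)%E measurable_cons_rV)).
Qed.

HB.instance Definition _ := isMeasure.Build _ _ _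
  lebesgue_rV_step step0 step_ge0 step_sigma_additive.

Let step_sigma_finite : sigma_finite setT lebesgue_rV_step.
Proof.
have [F FT mF] : sigma_finite setT (@lebesgue_measure R \x m)%E.
  have /sigma_finiteP[F [TF ndF Foo]] := sigma_finiteT (@lebesgue_measure R).
  have /sigma_finiteP[G [TG ndG Goo]] := sigma_finiteT m.
  exists (fun k => F k `*` G k) => [|k].
    rewrite -setXTT TF TG; apply/seteqP; split => -[x y].
      move=> [/= [i _ Fix] [j _ Gjy]]; exists (maxn i j) => //; split.
        by move: x Fix; exact/subsetPset/ndF/leq_maxl.
      by move: y Gjy; exact/subsetPset/ndG/leq_maxr.
    by move=> [k _ []/= ? ?]; split; exists k.
  have [? ?] := Foo k; have [? ?] := Goo k; split; first exact: measurableX.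
  by rewrite product_measure1E// lte_mul_pinfty// ge0_fin_numE.
exists (fun k => uncons_rV @^-1` F k) => [|k].
  by rewrite -preimage_bigcup -FT preimage_setT.
split; first by rewrite -[X in measurable X]setTI;
  apply: measurable_uncons_rV => //; exact: (mF k).1.
rewrite /lebesgue_rV_step /pushforward -comp_preimage.
rewrite (_ : _ \o _ = id) ?preimage_id; first exact: (mF k).2.
by apply/funext => p /=; rewrite cons_rVK.
Qed.

HB.instance Definition _ := Measure_isSigmaFinite.Build _ _ _
  lebesgue_rV_step step_sigma_finite.

End lebesgue_rV_step.

Fixpoint lebesgue_rV (R : realType) (n : nat) :
    {sigma_finite_measure set 'rV[R]_n -> \bar R} :=
  match n with
  | 0 => \d_(0 : 'rV[R]_0)
  | n'.+1 => lebesgue_rV_step (lebesgue_rV R n')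
  end.

(* This property characterizes the n-dimensional Lebesgue measure. *)
Lemma lebesgue_rV_box (R : realType) (n : nat) (A : 'I_n -> set R) :
  (forall i, measurable (A i)) ->
  lebesgue_rV R n [set x | forall i, A i (x 0 i)] =
  (\prod_(i < n) lebesgue_measure (A i))%E.
Proof.
elim: n A => [|n IHn] A mA.
  rewrite big_ord0 /= diracE mem_set//= => -[]//.
rewrite big_ord_recl -IHn//= /lebesgue_rV_step /pushforward.
rewrite -product_measure1E//=.
  congr ((_ \x _)%E _); apply/seteqP; split => [p Ap|p [Ap0 ApS] i] /=.
    split=> /= [|i]; first by have := Ap ord0; rewrite cons_rV0.
    by have := Ap (lift ord0 i); rewrite cons_rVS.
  case: (unliftP ord0 i) => [j ->|->]; first by rewrite cons_rVS; exact: ApS.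
  by rewrite cons_rV0.
  exact: mA.
rewrite (_ : (fun x : 'rV[R]_n => _) =
  \bigcap_(i in [set: 'I_n]) ((fun x : 'rV[R]_n => x 0 i) @^-1` A (lift ord0 i))).
  apply: fin_bigcap_measurable => [|i _]; first exact: finite_finset.
  by rewrite -[X in measurable X]setTI; apply: measurable_rV_coord.
by apply/seteqP; split => x Ax i => [_|]; [exact: (Ax i)|exact: (Ax i Logic.I)].
Qed.

(* The library norm `|x| on 'rV[R]_n is the sup norm. *)
Definition enorm (R : realType) (n : nat) (x : 'rV[R]_n) : R :=
  Num.sqrt (\sum_i x 0 i ^+ 2).

Definition eball (R : realType) (n : nat) (r : R) : set 'rV[R]_n :=
  [set x | enorm x < r].

Definition partial (R : realType) (n : nat) (i : 'I_n) (u : 'rV[R]_n -> R) :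
  'rV[R]_n -> R := fun x => 'D_(delta_mx 0 i) u x.

Definition gradient (R : realType) (n : nat) (u : 'rV[R]_n -> R)
  (x : 'rV[R]_n) : 'rV[R]_n := \row_i partial i u x.

Fixpoint Ck_open (R : realType) (n k : nat) (U : set 'rV[R]_n)
    (u : 'rV[R]_n -> R) : Prop :=
  (forall x, U x -> {for x, continuous u}) /\
  match k with
  | 0 => True
  | k'.+1 => forall i : 'I_n,
      (forall x, U x -> derivable u x (delta_mx 0 i)) /\
      Ck_open k' U (partial i u)
  end.

(* On a set A that is not open, C^k means C^k on a neighbourhood of A, so that
   derivatives at boundary points of A are unambiguous. *)
Definition Ck (R : realType) (n k : nat) (A : set 'rV[R]_n)
    (u : 'rV[R]_n -> R) : Prop :=
  exists U : set 'rV[R]_n, [/\ open U, A `<=` U & Ck_open k U u].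

Definition L2s (R : realType) (n : nat) (s : R) (u : 'rV[R]_n -> R) : Prop :=
  measurable_fun [set: 'rV[R]_n] u /\
  (\int[lebesgue_rV R n]_x
     (`|u x| / (1 + enorm x `^ (n%:R + 2 * s)))%:E < +oo)%E.

Definition frac_lap_trunc (R : realType) (n : nat) (s : R) (u : 'rV[R]_n -> R)
    (x : 'rV[R]_n) (e : R) : R :=
  \int[lebesgue_rV R n]_(y in [set y | e <= enorm (x - y)])
     ((u x - u y) / enorm (x - y) `^ (n%:R + 2 * s)).

(* (-Delta)^s u (x), for a normalization constant C. *)
Definition frac_lap (R : realType) (n : nat) (C s : R) (u : 'rV[R]_n -> R)
    (x : 'rV[R]_n) : R :=
  C * lim (frac_lap_trunc s u x e @[e --> 0^'+]).

(* lim is a total operator, hence the explicit existence of the principal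
   value. *)
Definition classical_supersolution (R : realType) (n : nat)
    (C s p q lambda : R) (A : set 'rV[R]_n) (u : 'rV[R]_n -> R) : Prop :=
  [/\ Ck 2 A u, L2s s u &
   forall x, A x ->
     cvg (frac_lap_trunc s u x e @[e --> 0^'+]) /\
     lambda * u x `^ p <= frac_lap C s u x + enorm (gradient u x) `^ q].

(* Main.v *)
(** The bubble [v x = (1 + |x|^2)^(-b)] is the superposition
    [v = const * \int_0^oo m(tau) G_tau dtau], [m(tau) = tau^(a-1) exp(-1/(2 tau))],
    [a = N/2 - b], of heat kernels [G_tau] (of variance [tau]), and the kernel of
    the fractional Laplacian is
    [|z|^(-N-2s) = const * \int_0^oo t^(-1-s) G_t(z) dt].
    As [G_t * G_tau = G_(t+tau)], the fractional Laplacian of [v] is, up to a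
    constant, the superposition of the [G_r] with weight the one-dimensional
    fractional derivative [\int_0^oo t^(-1-s) (m(r) - m(r-t)) dt].
    Since [m(r-t) <= exp(-1/(2r)) (r-t)^(a-1)] and
    [t^(-1-s) (r-t)^(s-1)] has the primitive [- t^(-s) (r-t)^s / (s r)], this
    weight is at least [const * exp(-1/(2r)) r^(a-s-1)] with a positive constant
    as soon as [a > s], that is [b < N/2 - s]. Hence
    [(-Delta)^s v >= const * (1 + |x|^2)^(-b-s)] on the whole space.
    With [b = s/(p-1)], which is allowed because [p > N/(N-2s)], the right-hand
    side is [const * v^p], and a small multiple of [v] is a supersolution; the
    gradient term is nonnegative and is discarded.

    The principal value is rewritten as the absolutely convergent integral of
    the symmetric second difference of [v]; truncating the time integral
    to [t >= e] gives integrals to which Tonelli's theorem applies, and dominated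
    convergence lets [e] tend to [0]. *)

Require Import Defs.
From mathcomp Require Import all_boot all_order all_algebra.
From mathcomp Require Import all_classical all_reals all_analysis.
From mathcomp Require Import measurable_realfun.
From mathcomp Require Import ring lra.

Set Implicit Arguments.
Unset Strict Implicit.
Unset Printing Implicit Defensive.

Import Order.TTheory GRing.Theory Num.Theory.
Import numFieldNormedType.Exports.

Local Open Scope classical_set_scope.
Local Open Scope ring_scope.

(** * Substitutions on the real line and on R^n *)

Section real_line_substitutions.
Context {R : realType}.
Local Notation mu := (@lebesgue_measure R).
Local Open Scope ereal_scope.

(** A measure on the line is determined by its values on the half-open intervals, and the
    push-forward under the reflection gives each of them its length; the swap of the open and the
    closed end is harmless. *)
Lemma ge0_integral_reflect (c : R) (f : R -> \bar R) :
  measurable_fun [set: R] f -> (forall t, 0 <= f t) ->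
  \int[mu]_t f (c - t)%R = \int[mu]_t f t.
Proof.
move=> mf f0.
have mphi : measurable_fun [set: R] (fun t : R => (c - t)%R : measurableTypeR R).
  exact: measurable_funB.
transitivity (\int[pushforward mu (fun t : R => (c - t)%R : measurableTypeR R)]_t f t).
  by rewrite ge0_integral_pushforward.
apply: eq_measure_integral => //= A mA _; apply/esym.
pose nu := measure_function_pushforward__canonical__measure_function_Measure mu mphi.
apply: (@lebesgue_measure_unique R nu) => //= _ [[a b]] _ <-.
rewrite /pushforward.
rewrite (_ : _ @^-1` _ = `[(c - b)%R, (c - a)%R[%classic); last first.
  apply/seteqP; split => t /=; rewrite !in_itv/= => /andP[? ?].
    by apply/andP; split; lra.
  by apply/andP; split; lra.
rewrite !lebesgue_measure_itv/= !lte_fin.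
by rewrite ltrD2l ltrN2 -!EFinD; case: ifP => // _; congr (_%:E); ring.
Qed.

(** A translation is the composite of two reflections. *)
Lemma ge0_integral_translate (c : R) (f : R -> \bar R) :
  measurable_fun [set: R] f -> (forall t, 0 <= f t) ->
  \int[mu]_t f (t + c)%R = \int[mu]_t f t.
Proof.
move=> mf f0; rewrite -[RHS](ge0_integral_reflect c)//.
rewrite -[RHS](ge0_integral_reflect 0)//; last first.
  by apply: measurableT_comp => //; exact: measurable_funB.
by apply: eq_integral => t _; congr f; ring.
Qed.

(** The push-forward divides lengths by [k]; rescaled by [k] it agrees with Lebesgue measure on
    intervals, hence everywhere. *)
Lemma ge0_integral_dilate (k : R) (f : R -> \bar R) : (0 < k)%R ->
  measurable_fun [set: R] f -> (forall t, 0 <= f t) ->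
  k%:E * \int[mu]_t f (k * t)%R = \int[mu]_t f t.
Proof.
move=> k0 mf f0.
have mphi : measurable_fun [set: R] (fun t : R => (k * t)%R : measurableTypeR R).
  exact: measurable_funM.
transitivity (k%:E *
    \int[pushforward mu (fun t : R => (k * t)%R : measurableTypeR R)]_t f t).
  by rewrite ge0_integral_pushforward.
pose nu := measure_function_pushforward__canonical__measure_function_Measure mu mphi.
pose k' := NngNum (ltW k0).
transitivity (\int[mscale k' nu]_t f t).
  by rewrite ge0_integral_mscale.
apply: eq_measure_integral => //= A mA _; apply/esym.
apply: (@lebesgue_measure_unique R (mscale k' nu)) => //= _ [[a b]] _ <-.
rewrite /mscale/= /pushforward.
rewrite (_ : _ @^-1` _ = `](a / k)%R, (b / k)%R]%classic); last first.
  by apply/seteqP; split => t /=; rewrite !in_itv/=;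
    rewrite ltr_pdivrMr// ler_pdivlMr// !(mulrC k).
rewrite !lebesgue_measure_itv/= !lte_fin.
rewrite ltr_pM2r ?invr_gt0// -!EFinD; case: ifP => // _.
  by rewrite -EFinM -mulrBl mulrC divfK ?gt_eqF.
by rewrite mule0.
Qed.

End real_line_substitutions.

(** * Slicing and reflections in R^n *)

Section euclidean_integration.
Context {R : realType}.
Local Notation mu := (@lebesgue_measure R).
Local Open Scope ereal_scope.

(** By construction the measure in dimension [n.+1] is the push-forward of a product measure under
    [cons_rV], so this is Tonelli's theorem. *)
Lemma ge0_integral_rVS n (f : 'rV[R]_n.+1 -> \bar R) :
  measurable_fun [set: 'rV[R]_n.+1] f -> (forall x, 0 <= f x) ->
  \int[lebesgue_rV R n.+1]_x f x =
  \int[mu]_a \int[lebesgue_rV R n]_y f (cons_rV (a, y)).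
Proof.
move=> mf f0.
transitivity (\int[pushforward (mu \x lebesgue_rV R n) (@cons_rV R n)]_x f x).
  by apply: eq_measure_integral => *; first exact: measurable_cons_rV.
rewrite ge0_integral_pushforward//; last exact: measurable_cons_rV.
rewrite preimage_setT fubini_tonelli1//.
- by apply: (measurableT_comp mf); exact: measurable_cons_rV.
- by move=> p /=.
Qed.

Lemma measurable_rV_reflect n (x : 'rV[R]_n) :
  measurable_fun [set: 'rV[R]_n] (fun z => x - z)%R.
Proof.
apply/measurable_fun_rVP => i; under eq_fun do rewrite !mxE.
by apply: measurable_funB => //; exact: measurable_rV_coord.
Qed.

(** Induction on the dimension: the first coordinate is reflected on the line, the others by the
    induction hypothesis. *)
Lemma ge0_integral_rV_reflect n (x : 'rV[R]_n) (f : 'rV[R]_n -> \bar R) :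
  measurable_fun [set: 'rV[R]_n] f -> (forall z, 0 <= f z) ->
  \int[lebesgue_rV R n]_z f (x - z)%R = \int[lebesgue_rV R n]_z f z.
Proof.
elim: n x f => [|n IH] x f mf f0.
  by apply: eq_integral => z _; congr f; apply/rowP => -[].
have mfx : measurable_fun [set: 'rV[R]_n.+1] (fun z => f (x - z)%R).
  by apply: (measurableT_comp mf); exact: measurable_rV_reflect.
rewrite !ge0_integral_rVS//.
pose g (t : R) := \int[lebesgue_rV R n]_y f (cons_rV (t, y)).
have mfc : measurable_fun [set: R * 'rV[R]_n] (fun p => f (cons_rV p)).
  by apply: (measurableT_comp mf); exact: measurable_cons_rV.
rewrite -(ge0_integral_reflect (x 0 0)%R (f := g)).
- apply: eq_integral => a _; rewrite /g.
  rewrite -(IH (uncons_rV x).2 (fun y => f (cons_rV ((x 0 0 - a)%R, y)))).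
  + apply: eq_integral => y _; congr f; apply/rowP => i.
    case: (unliftP ord0 i) => [j ->|->].
      by rewrite [RHS]cons_rVS mxE [X in (_ + X)%R]mxE cons_rVS/= !mxE.
    by rewrite [RHS]cons_rV0 mxE [X in (_ + X)%R]mxE cons_rV0.
  + by apply: (measurableT_comp mfc); exact: pair1_measurable.
  + by [].
- exact: (measurable_fun_fubini_tonelli_F (fun p => f (cons_rV p))).
- by move=> t; exact: integral_ge0.
Qed.

Lemma ge0_integral_rV_opp n (f : 'rV[R]_n -> \bar R) :
  measurable_fun [set: 'rV[R]_n] f -> (forall z, 0 <= f z) ->
  \int[lebesgue_rV R n]_z f (- z)%R = \int[lebesgue_rV R n]_z f z.
Proof.
move=> mf f0; rewrite -[RHS](ge0_integral_rV_reflect 0)//.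
by apply: eq_integral => z _; rewrite sub0r.
Qed.

End euclidean_integration.

(** * The heat kernel *)

Section heat_kernel.
Context {R : realType}.
Local Notation mu := (@lebesgue_measure R).

Lemma measurable_invr : measurable_fun [set: R] (@GRing.inv R).
Proof.
(* Inversion is written as an odd extension of the power function of exponent -1, which is
   measurable; at 0 both take the value 0. *)
rewrite (_ : GRing.inv = fun t : R =>
    if 0 <= t then t `^ (-1) else - (- t) `^ (-1)); last first.
  apply/funext => t; case: ifPn => [t0|]; first by rewrite powR_inv1.
  by rewrite -ltNge => t0; rewrite powR_inv1 ?invrN ?opprK// oppr_ge0 ltW.
apply: measurable_fun_ifT => //.
- exact: measurable_fun_ler.
- apply: measurableT_comp => //.
  by apply: (measurableT_comp (measurable_powR (-1))); exact: measurable_funN.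
Qed.

Definition sqnorm n (x : 'rV[R]_n) : R := \sum_i x 0 i ^+ 2.

Lemma sqnorm_ge0 n (x : 'rV[R]_n) : 0 <= sqnorm x.
Proof. by apply: sumr_ge0 => i _; exact: sqr_ge0. Qed.

Lemma sqnorm_eq0 n (x : 'rV[R]_n) : (sqnorm x == 0) = (x == 0).
Proof.
apply/eqP/eqP => [|->]; last first.
  by rewrite /sqnorm big1// => i _; rewrite mxE expr0n.
move=> /psumr_eq0P x0; apply/rowP => i; rewrite mxE.
by apply/eqP; rewrite -sqrf_eq0 x0// => j _; exact: sqr_ge0.
Qed.

Lemma sqnormN n (x : 'rV[R]_n) : sqnorm (- x) = sqnorm x.
Proof. by apply: eq_bigr => i _; rewrite mxE sqrrN. Qed.

Lemma sqnorm_cons n (p : R * 'rV[R]_n) :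
  sqnorm (cons_rV p) = p.1 ^+ 2 + sqnorm p.2.
Proof.
rewrite /sqnorm big_ord_recl cons_rV0; congr (_ + _).
by apply: eq_bigr => i _; rewrite cons_rVS.
Qed.

Lemma measurable_sqnorm n : measurable_fun [set: 'rV[R]_n] (@sqnorm n).
Proof.
apply: measurable_sum => i; apply: measurable_funX.
exact: measurable_rV_coord.
Qed.

(** The centred Gaussian density of covariance [t] times the identity, that is, the kernel of exp(t
    Laplacian / 2). In this normalization it is a product of densities [normal_pdf] of variance
    [t]. *)
Definition heat n (t : R) (x : 'rV[R]_n) : R :=
  (2 * pi * t) `^ (- (n%:R / 2)) * expR (- (sqnorm x / (2 * t))).

Lemma heat_ge0 n t (x : 'rV[R]_n) : 0 <= heat t x.
Proof. by rewrite mulr_ge0 ?powR_ge0 ?expR_ge0. Qed.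

Lemma heatN n t (x : 'rV[R]_n) : heat t (- x) = heat t x.
Proof. by rewrite /heat sqnormN. Qed.

Lemma measurable_heat n :
  measurable_fun [set: R * 'rV[R]_n] (fun p => heat p.1 p.2).
Proof.
apply: measurable_funM.
  apply: (measurableT_comp (measurable_powR _)).
  exact: measurable_funM.
apply: measurableT_comp => //; apply: measurableT_comp => //.
apply: measurable_funM.
  by apply: measurableT_comp => //; exact: measurable_sqnorm.
apply: (measurableT_comp measurable_invr).
exact: measurable_funM.
Qed.

Lemma measurable_heat_swap n :
  measurable_fun [set: 'rV[R]_n * R] (fun p => heat p.2 p.1).
Proof.
apply: (measurableT_comp (@measurable_heat n)
  (_ : measurable_fun _ (fun p : 'rV[R]_n * R => (p.2, p.1)))).
by apply/measurable_fun_pairP; split; [exact: measurable_snd|exact: measurable_fst].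
Qed.

Lemma measurable_heatr n t : measurable_fun [set: 'rV[R]_n] (@heat n t).
Proof. exact: (measurable_fun_pair2 t (@measurable_heat n)). Qed.

Lemma measurable_heatl n (x : 'rV[R]_n) :
  measurable_fun [set: R] (fun t => heat t x).
Proof.
apply: (measurableT_comp (@measurable_heat n)
  (_ : measurable_fun _ (fun t : R => (t, x)))).
exact: measurable_fun_pair.
Qed.

Lemma heat1E (t a : R) : 0 < t ->
  normal_pdf 0 (Num.sqrt t) a =
  (2 * pi * t) `^ (- (1 / 2)) * expR (- (a ^+ 2 / (2 * t))).
Proof.
move=> t0; rewrite normal_pdfE ?gt_eqF ?sqrtr_gt0//.
rewrite /normal_peak /normal_fun sqr_sqrtr ?(ltW t0)// subr0.
congr (_ * _); last by congr expR; rewrite mulNr mulr_natl.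
rewrite powRN div1r powR12_sqrt ?mulr_ge0 ?pi_ge0 ?(ltW t0)//.
by congr (Num.sqrt _)^-1; rewrite -mulr_natl; ring.
Qed.

Lemma heat_cons n t (p : R * 'rV[R]_n) : 0 < t ->
  heat t (cons_rV p) = normal_pdf 0 (Num.sqrt t) p.1 * heat t p.2.
Proof.
move=> t0; rewrite heat1E// /heat sqnorm_cons.
rewrite mulrACA -expRD -powRD; last first.
  by apply/implyP => _; rewrite gt_eqF// !mulr_gt0// pi_gt0.
rewrite -natr1; congr (_ `^ _ * expR _); first by field.
by field; rewrite gt_eqF.
Qed.

Lemma heat0 t (x : 'rV[R]_0) : heat t x = 1.
Proof. by rewrite /heat /sqnorm big_ord0 !mul0r oppr0 powRr0 expR0 mulr1. Qed.

Let variance_mul (w t r : R) : t + r != 0 ->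
  t * w *+ 2 * (r * w *+ 2) = (t + r) * w *+ 2 * (t * r / (t + r) * w *+ 2).
Proof. by move=> ?; rewrite !mulr2n; field. Qed.

Let complete_square (t r c a : R) : t != 0 -> r != 0 -> t + r != 0 ->
  - a ^+ 2 / (t *+ 2) + - (c - a) ^+ 2 / (r *+ 2) =
  - c ^+ 2 / ((t + r) *+ 2) +
  - (a - c * t / (t + r)) ^+ 2 / (t * r / (t + r) *+ 2).
Proof.
move=> t0 r0 tr0.
have -> : (t * r / (t + r) *+ 2)^-1 = (t^-1 + r^-1) / 2.
  by rewrite -mulr_natr; field; rewrite t0 r0 tr0.
by rewrite !mulr2n; field; rewrite -!mulr2n !mulrn_eq0/= t0 r0 tr0.
Qed.

(** Completing the square in [a]: the whole dependence on [a] is a Gaussian of variance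
    [t * r / (t + r)]. Its integral is 1, which yields the semigroup property in dimension one. *)
Lemma normal_pdf_mul (t r c a : R) : 0 < t -> 0 < r ->
  normal_pdf 0 (Num.sqrt t) a * normal_pdf 0 (Num.sqrt r) (c - a) =
  normal_pdf 0 (Num.sqrt (t + r)) c *
  normal_pdf (c * t / (t + r)) (Num.sqrt (t * r / (t + r))) a.
Proof.
move=> t0 r0.
have tr0 : 0 < t + r by exact: addr_gt0.
have v0 : 0 < t * r / (t + r) by rewrite divr_gt0// mulr_gt0.
rewrite !normal_pdfE ?gt_eqF ?sqrtr_gt0// /normal_peak /normal_fun.
rewrite !sqr_sqrtr ?ltW// mulrACA [RHS]mulrACA -!invfM -!expRD.
have pi2 := @pi_ge0 R.
congr (_^-1 * expR _).
  rewrite -!sqrtrM ?mulrn_wge0 ?mulr_ge0 ?(ltW t0) ?(ltW tr0) //.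
  by rewrite variance_mul ?gt_eqF.
by rewrite !subr0 complete_square ?gt_eqF.
Qed.

Local Open Scope ereal_scope.

Lemma integral_heat n (t : R) : (0 < t)%R ->
  \int[lebesgue_rV R n]_x (heat t x)%:E = 1.
Proof.
move=> t0; elim: n => [|n IH].
  under eq_integral do rewrite heat0.
  by rewrite integral_cst//= diracT mule1.
rewrite ge0_integral_rVS; last 2 first.
- by apply/measurable_EFinP; exact: measurable_heatr.
- by move=> x; rewrite lee_fin heat_ge0.
rewrite -(integral_normal_pdf 0 (Num.sqrt t)).
apply: eq_integral => a _.
rewrite (eq_integral
    (fun y => (normal_pdf 0 (Num.sqrt t) a)%:E * (heat t y)%:E)); last first.
  by move=> y _; rewrite heat_cons// EFinM.
rewrite ge0_integralZl//=.
- by rewrite IH mule1.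
- by apply/measurable_EFinP; exact: measurable_heatr.
- by move=> y _; rewrite lee_fin heat_ge0.
- by rewrite lee_fin normal_pdf_ge0.
Qed.

(** Induction on the dimension: the Gaussian factors, the last coordinates are covered by the
    induction hypothesis and the first one by [normal_pdf_mul]. *)
Lemma heat_convolution n (t r : R) (x : 'rV[R]_n) : (0 < t)%R -> (0 < r)%R ->
  \int[lebesgue_rV R n]_z (heat t z * heat r (x - z))%:E = (heat (t + r) x)%:E.
Proof.
move=> t0 r0; elim: n x => [|n IH] x.
  under eq_integral do rewrite !heat0 mulr1.
  by rewrite integral_cst//= diracT mule1 heat0.
have tr0 : (0 < t + r)%R by exact: addr_gt0.
have mh m (y : 'rV[R]_m) :
    measurable_fun [set: 'rV[R]_m] (fun z => (heat t z * heat r (y - z))%:E).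
  apply/measurable_EFinP; apply: measurable_funM; first exact: measurable_heatr.
  by apply: (measurableT_comp (@measurable_heatr m r)); exact: measurable_rV_reflect.
rewrite ge0_integral_rVS; last 2 first.
- exact: mh.
- by move=> z; rewrite lee_fin mulr_ge0// heat_ge0.
transitivity (\int[mu]_a
    ((normal_pdf 0 (Num.sqrt t) a * normal_pdf 0 (Num.sqrt r) (x 0 0 - a))%:E *
     (heat (t + r) (uncons_rV x).2)%:E)).
  apply: eq_integral => a _; rewrite -IH.
  rewrite -ge0_integralZl//=.
  - apply: eq_integral => y _.
    rewrite (_ : x - cons_rV (a, y) = cons_rV (x 0 0 - a, (uncons_rV x).2 - y))%R.
      by rewrite !heat_cons//= -EFinM mulrACA.
    rewrite -[in LHS](uncons_rVK x); apply/rowP => i.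
    case: (unliftP ord0 i) => [j ->|->].
      by rewrite [RHS]cons_rVS mxE [X in (_ + X)%R]mxE !cons_rVS/= !mxE.
    by rewrite [RHS]cons_rV0 mxE [X in (_ + X)%R]mxE !cons_rV0.
  - exact: mh.
  - by move=> y _; rewrite lee_fin mulr_ge0// heat_ge0.
  - by rewrite lee_fin mulr_ge0// normal_pdf_ge0.
transitivity (\int[mu]_a ((normal_pdf 0 (Num.sqrt (t + r)%R) (x 0 0) *
      heat (t + r) (uncons_rV x).2)%:E *
    (normal_pdf (x 0 0 * t / (t + r))%R (Num.sqrt (t * r / (t + r))%R) a)%:E)).
  by apply: eq_integral => a _; rewrite normal_pdf_mul// -!EFinM mulrAC.
rewrite -(heat_cons (_, _))// ge0_integralZl//=.
- by rewrite integral_normal_pdf mule1 uncons_rVK.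
- by apply/measurable_EFinP; exact: measurable_normal_pdf.
- by move=> a _; rewrite lee_fin normal_pdf_ge0.
- by rewrite lee_fin heat_ge0.
Qed.

End heat_kernel.

(** * One-dimensional integrals *)

Section one_dimensional_integrals.
Context {R : realType}.
Local Notation mu := (@lebesgue_measure R).

Lemma is_derive_continuous (F : R -> R) (x d : R) :
  is_derive x 1 F d -> {for x, continuous F}.
Proof.
by move=> dF; apply: differentiable_continuous; apply/derivable1_diffP; case: dF.
Qed.

Lemma FTC2_is_derive (F f : R -> R) (a b : R) : a < b ->
  (forall t, a <= t <= b -> is_derive t 1 F (f t)) ->
  (forall t, a <= t <= b -> {for t, continuous f}) ->
  (\int[mu]_(t in `[a, b]) (f t)%:E = (F b - F a)%:E)%E.
Proof.
move=> ab dF cf; rewrite EFinB; apply: continuous_FTC2 => //.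
- apply: continuous_in_subspaceT => t; rewrite inE/= in_itv/= => tab.
  exact: cf.
- split.
  + by move=> t; rewrite in_itv/= => /andP[at_ tb]; have [] := dF t; rewrite ?ltW.
  + apply: cvg_at_right_filter; apply: (is_derive_continuous (dF a _)).
    by rewrite lexx ltW.
  + apply: cvg_at_left_filter; apply: (is_derive_continuous (dF b _)).
    by rewrite lexx ltW.
- move=> t; rewrite in_itv/= => /andP[at_ tb]; rewrite derive1E.
  by have [] := dF t; rewrite ?ltW.
Qed.

Lemma FTC2y_is_derive (F f : R -> R) (a l : R) :
  (forall t, a <= t -> 0 <= f t) ->
  (forall t, a <= t -> is_derive t 1 F (f t)) ->
  (forall t, a <= t -> {for t, continuous f}) ->
  F x @[x --> +oo] --> l ->
  (\int[mu]_(t in `[a, +oo[) (f t)%:E = (l - F a)%:E)%E.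
Proof.
move=> f0 dF cf Fl; rewrite EFinB; apply: ge0_continuous_FTC2y => //.
- apply: continuous_in_subspaceT => t; rewrite inE/= in_itv/= andbT => tab.
  exact: cf.
- by move=> t /ltW/dF[].
- by apply: cvg_at_right_filter; exact: (is_derive_continuous (dF a _)).
- by move=> t; rewrite in_itv/= andbT derive1E => /ltW/dF[].
Qed.

Lemma continuous_powR (c t : R) : 0 < t -> {for t, continuous (fun x : R => x `^ c)}.
Proof. by move=> t0; exact: (is_derive_continuous (is_derive1_powR c t0)). Qed.

Lemma powR_le_base (c x y : R) : 0 <= c -> 0 <= x -> x <= y -> x `^ c <= y `^ c.
Proof. by move=> c0 x0 xy; rewrite ge0_ler_powR// nnegrE// (le_trans x0). Qed.

Lemma powR2_lt1 (c : R) : c < 0 -> 2 `^ c < 1.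
Proof.
move=> c0; rewrite -[ltRHS](@powRr0 R 2) /powR pnatr_eq0/=.
by rewrite ltr_expR ltr_pM2r ?ln_gt0// ltr1n.
Qed.

Lemma powRN_cvgy (c : R) : 0 < c -> t `^ (- c) @[t --> +oo] --> 0.
Proof.
move=> c0; apply/cvgr0Pnorm_lt => e e0; near=> t.
have t0 : 0 < t by near: t; exact: nbhs_pinfty_gt.
have te : e `^ (- c^-1) < t by near: t; exact: nbhs_pinfty_gt.
rewrite ger0_norm ?powR_ge0// powRN invf_plt ?posrE ?powR_gt0//.
rewrite -powR_inv1 ?ltW// -[X in X < _](_ : (e `^ (- c^-1)) `^ c = _).
  by rewrite gt0_ltr_powR// nnegrE ?powR_ge0// ltW.
by rewrite -powRrM mulNr mulVf ?gt_eqF.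
Unshelve. all: by end_near. Qed.

Lemma integral_powRy (c e : R) : 0 < c -> 0 < e ->
  (\int[mu]_(t in `[e, +oo[) (t `^ (- 1 - c))%:E = (e `^ (- c) / c)%:E)%E.
Proof.
move=> c0 e0.
have -> : e `^ (- c) / c = 0 - (- c^-1 * e `^ (- c)).
  by rewrite sub0r mulNr opprK mulrC.
apply: (@FTC2y_is_derive (fun t => - c^-1 * t `^ (- c))).
- by move=> t _; exact: powR_ge0.
- move=> t et; have t0 := lt_le_trans e0 et.
  have h := is_derive1_powR (- c) t0.
  have -> : t `^ (- 1 - c) = (- c^-1) *: (- c * t `^ (- c - 1)).
    rewrite [RHS]mulrA mulrNN mulVf ?gt_eqF// mul1r; congr (_ `^ _); ring.
  exact: is_deriveZ.
- by move=> t et; apply: continuous_powR; exact: lt_le_trans et.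
- rewrite -(mulr0 (- c^-1)); apply: cvgMl_tmp; exact: powRN_cvgy.
Qed.

(** The function is a multiple of [((r - t) / t)^s], and the derivative of [(r - t) / t] is
    [- r / t^2]. This makes the time integral with exponent [s - 1] explicit; other exponents are
    compared with it. *)
Lemma marchaud_antiderivative (s r t : R) : s != 0 -> 0 < t < r ->
  is_derive t 1 (fun t => - ((t `^ (- s) * (r - t) `^ s) / (s * r)))
    (t `^ (- 1 - s) * (r - t) `^ (s - 1)).
Proof.
move=> s0 /andP[t0 tr]; have rt0 : 0 < r - t by rewrite subr_gt0.
have h1 := is_derive1_powR (- s) t0.
have h2 : is_derive t 1 (fun t => r - t) (0 - 1) by exact: is_deriveB.
have h3 : is_derive t 1 (fun t => (r - t) `^ s) ((s * (r - t) `^ (s - 1)) * (0 - 1)).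
  have h := is_derive1_powR s rt0.
  exact: (@is_derive1_comp _ (fun x => x `^ s) (fun t => r - t) t _ _ h h2).
have h4 := is_deriveM h1 h3.
have h5 := is_deriveN (is_deriveM h4 (is_derive_cst (s * r)^-1 t 1)).
apply: (is_derive_eq h5); rewrite /GRing.scale/=.
have -> : t `^ (- s) = t * t `^ (- 1 - s).
  rewrite -[X in X * _]powRr1 ?ltW// -powRD; first by congr (_ `^ _); ring.
  by rewrite (gt_eqF t0) implybT.
have -> : (r - t) `^ s = (r - t) * (r - t) `^ (s - 1).
  rewrite -[X in X * _]powRr1 ?ltW// -powRD; first by congr (_ `^ _); ring.
  by rewrite (gt_eqF rt0) implybT.
have -> : - s - 1 = - 1 - s by ring.
set A := t `^ _; set B := _ `^ (s - 1).
by field; rewrite s0/= gt_eqF// (lt_trans t0).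
Qed.

End one_dimensional_integrals.

(** * Truncated fractional derivative of a power *)

Section power_convolution.
Context {R : realType}.
Local Notation mu := (@lebesgue_measure R).
Variables (s r : R).
Hypotheses (s0 : 0 < s) (r0 : 0 < r).

(** [- P] is an antiderivative of [Q] on ]0, r[, and [P] vanishes at [r]. *)
Let Q (t : R) := t `^ (- 1 - s) * (r - t) `^ (s - 1).
Let P (t : R) := (t `^ (- s) * (r - t) `^ s) / (s * r).

Let Q_ge0 t : 0 <= Q t. Proof. by rewrite mulr_ge0 ?powR_ge0. Qed.

Let P_ge0 t : 0 <= P t.
Proof. by rewrite divr_ge0 ?mulr_ge0 ?powR_ge0// ltW. Qed.

Let continuous_Q (t : R) : 0 < t < r -> {for t, continuous Q}.
Proof.
move=> /andP[t0 tr]; apply: cvgM; first exact: continuous_powR.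
have rt0 : 0 < r - t by rewrite subr_gt0.
apply: (@continuous_comp _ _ _ (fun t => r - t) (fun x => x `^ (s - 1))).
  by apply: cvgB; [exact: cvg_cst|exact: cvg_id].
exact: continuous_powR.
Qed.

Let measurable_kernel c : measurable_fun [set: R]
  (fun t : R => (t `^ (- 1 - s) * (r - t) `^ c)%:E).
Proof.
apply/measurable_EFinP; apply: measurable_funM => //.
by apply: (measurableT_comp (measurable_powR c)); exact: measurable_funB.
Qed.

Let integral_Q (a b : R) : 0 < a -> a < b -> b < r ->
  (\int[mu]_(t in `[a, b]) (Q t)%:E = (P a - P b)%:E)%E.
Proof.
move=> a0 ab br.
have -> : P a - P b = (- P b) - (- P a) by rewrite opprK addrC.
have in0r t : a <= t <= b -> 0 < t < r.
  by move=> /andP[at_ tb]; rewrite (lt_le_trans a0)//= (le_lt_trans tb).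
apply: (@FTC2_is_derive _ (fun t => - P t)) => // t /in0r ?.
- by apply: marchaud_antiderivative; rewrite ?gt_eqF.
- exact: continuous_Q.
Qed.

Let integral_Q_le (a : R) : 0 < a -> a < r ->
  (\int[mu]_(t in `[a, r[) (Q t)%:E <= (P a)%:E)%E.
Proof.
move=> a0 ar.
(* [Q] may blow up at [r], so the interval is exhausted from the left. The denominator starts at 2
   in order that already [b 0] exceeds [a] strictly. *)
pose b n : R := r - (r - a) / n.+2%:R.
have ra0 : 0 < r - a by rewrite subr_gt0.
have ab n : a < b n.
  rewrite /b ltrBrDr -ltrBrDl ltr_pdivrMr// ltr_pMr//.
  by rewrite (_ : 1 = 1%:R)// ltr_nat.
have br n : b n < r by rewrite /b ltrBlDr ltrDl divr_gt0.
have -> : `[a, r[%classic = \bigcup_n `[a, b n]%classic.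
  apply/seteqP; split => t /=; rewrite in_itv/=.
    move=> /andP[at_ tr].
    have rt0 : 0 < r - t by rewrite subr_gt0.
    pose k := Num.truncn ((r - a) / (r - t)).
    exists k => //=; rewrite in_itv/= at_/= /b lerBrDr -lerBrDl.
    rewrite ler_pdivrMr// mulrC -ler_pdivrMr//.
    rewrite (@le_trans _ _ k.+1%:R)// ?ler_nat//.
    by rewrite ltW// truncnS_gt.
  move=> [n _ /=]; rewrite in_itv/= => /andP[-> tb]/=.
  exact: le_lt_trans tb (br n).
have mQ := measurable_kernel (s - 1).
have cQ : (\int[mu]_(t in `[a, b n]) (Q t)%:E @[n --> \oo] -->
    \int[mu]_(t in \bigcup_n `[a, b n]%classic) (Q t)%:E)%E.
  apply: ge0_nondecreasing_set_cvg_integral => //.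
  - move=> m n mn; rewrite subsetEset => t /=; rewrite !in_itv/=.
    move=> /andP[-> /le_trans]/=; apply.
    by rewrite lerB// ler_pM2l// lef_pV2 ?posrE// ler_nat !ltnS.
  - by move=> i; exact: measurable_funTS.
  - by move=> i t _; rewrite lee_fin.
rewrite -(cvg_lim _ cQ)//; apply: lime_le; first by apply/cvg_ex; eexists; exact: cQ.
by apply: nearW => n; rewrite integral_Q// lee_fin lerBlDr lerDl.
Qed.

(** Since [c > s], the kernel is [Q] times the power [(r - t)^(c - s)], which decreases in [t] and
    is at most its value at [a]. *)
Let integral_kernel_le (a c : R) (D : set R) : s < c -> measurable D ->
  0 < a -> a < r -> D `<=` `[a, r[ ->
  (\int[mu]_(t in D) (t `^ (- 1 - s) * (r - t) `^ (c - 1))%:E <=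
   ((r - a) `^ (c - s))%:E * \int[mu]_(t in D) (Q t)%:E)%E.
Proof.
move=> sc mD a0 ar Dar; rewrite -ge0_integralZl//=; last 3 first.
- by apply: measurable_funTS; exact: measurable_kernel.
- by move=> t _; rewrite lee_fin.
- by rewrite lee_fin powR_ge0.
apply: ge0_le_integral => //.
- by move=> t _; rewrite lee_fin mulr_ge0 ?powR_ge0.
- by apply: measurable_funTS; exact: measurable_kernel.
- apply: emeasurable_funM => //.
  by apply: measurable_funTS; exact: measurable_kernel.
move=> t /Dar; rewrite /= in_itv/= => /andP[at_ tr].
have rt0 : 0 < r - t by rewrite subr_gt0.
rewrite -EFinM lee_fin /Q mulrCA ler_wpM2l ?powR_ge0//.
have -> : c - 1 = (c - s) + (s - 1) by ring.
rewrite powRD ?(gt_eqF rt0) ?implybT// ler_wpM2r ?powR_ge0//.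
by rewrite powR_le_base ?subr_ge0 ?(ltW sc) ?(ltW tr)// lerD2l lerN2.
Qed.

Let P_le (a : R) : 0 < a -> a < r -> P a <= a `^ (- s) * r `^ (s - 1) / s.
Proof.
move=> a0 ar; rewrite /P invfM mulrA mulrAC ler_pM2r ?invr_gt0//.
rewrite -mulrA ler_wpM2l ?powR_ge0//.
have -> : r `^ (s - 1) = r `^ s / r by rewrite powRB ?(gt_eqF r0) ?implybT// powRr1 ?ltW.
rewrite ler_wpM2r ?invr_ge0 ?(ltW r0)// powR_le_base ?subr_ge0 ?(ltW s0) ?(ltW ar)//.
by rewrite gerBl (ltW a0).
Qed.

(** As [e^(-s) / s] is the integral of [t^(-1-s)] over [e, +oo[, this bounds from below the
    truncated fractional derivative of [r^(c-1)]. The gain comes from [r/2, r[, where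
    [(r - t)^(c - s)] is at most [2^(s-c) r^(c-s)] instead of [r^(c-s)]; it is claimed only if
    [r / 2] lies beyond [e]. *)
Lemma power_convolution_le (c e : R) : s < c -> 0 < e -> e < r ->
  (\int[mu]_(t in `[e, r[) (t `^ (- 1 - s) * (r - t) `^ (c - 1))%:E <=
   (r `^ (c - 1) * (e `^ (- s) / s) -
    (if 2 * e < r then (1 - 2 `^ (s - c)) / s * r `^ (c - s - 1) else 0))%:E)%E.
Proof.
move=> sc e0 er.
have Pe : r `^ (c - s) * P e <= r `^ (c - 1) * (e `^ (- s) / s).
  rewrite (le_trans (ler_wpM2l (powR_ge0 _ _) (P_le e0 er)))//.
  rewrite [X in _ <= X](_ : _ = r `^ (c - s) * (e `^ (- s) * r `^ (s - 1) / s))//.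
  have -> : c - 1 = (c - s) + (s - 1) by ring.
  by rewrite powRD ?(gt_eqF r0) ?implybT//; ring.
case: ifPn => [er2|_]; last first.
  rewrite subr0.
  apply: (le_trans (integral_kernel_le sc _ e0 er _)) => //.
  apply: le_trans (lee_wpmul2l _ (integral_Q_le e0 er)) _.
    by rewrite lee_fin powR_ge0.
  rewrite -EFinM lee_fin; apply: le_trans Pe.
  rewrite ler_wpM2r// powR_le_base ?subr_ge0 ?(ltW sc) ?(ltW er)//.
  by rewrite gerBl (ltW e0).
have hr : r / 2 < r by lra.
have hr0 : 0 < r / 2 by lra.
have ehr : e < r / 2 by lra.
have mk := measurable_kernel (c - 1).
rewrite (@itv_bndbnd_setU _ _ _ (BRight (r / 2))) ?bnd_simp ?(ltW ehr)//.
rewrite ge0_integral_setU//=; last 3 first.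
- exact: measurable_funTS.
- by move=> t _; rewrite lee_fin mulr_ge0 ?powR_ge0.
- apply/disj_setPS => t /= []; rewrite !in_itv/= => /andP[_ h] /andP[h' _]; lra.
(* The comparison with [Q] is made separately on the two halves, each time with the value of
   [(r - t)^(c - s)] at, or a bound for it up to, the left end. *)
apply: (@le_trans _ _ ((r `^ (c - s) * (P e - P (r / 2)))%:E +
   ((r / 2) `^ (c - s) * P (r / 2))%:E)%E).
  apply: leeD.
  - apply: (le_trans (integral_kernel_le sc _ e0 er _)) => //.
      by move=> t /=; rewrite !in_itv/= => /andP[-> h]/=; rewrite (le_lt_trans h).
    rewrite integral_Q// -EFinM lee_fin ler_wpM2r//.
      have := integral_Q e0 ehr hr; move=> h; rewrite -lee_fin -h.
      by apply: integral_ge0 => t _; rewrite lee_fin.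
    rewrite powR_le_base ?subr_ge0 ?(ltW sc) ?(ltW er)//.
    by rewrite gerBl (ltW e0).
  - apply: (le_trans (integral_kernel_le sc _ hr0 hr _)) => //.
      by move=> t /=; rewrite !in_itv/= => /andP[h ->]/=; rewrite ltW.
    rewrite EFinM (_ : r - r / 2 = r / 2)%R; last by field.
    apply: lee_wpmul2l; first by rewrite lee_fin powR_ge0.
    apply: le_trans (integral_Q_le hr0 hr).
    apply: ge0_subset_integral => //.
    - by apply: measurable_funTS; exact: measurable_kernel.
    - by move=> t _; rewrite lee_fin.
    - by move=> t /=; rewrite !in_itv/= => /andP[h ->]; rewrite ltW.
rewrite -EFinD lee_fin.
have -> : P (r / 2) = (s * r)^-1.
  rewrite /P (_ : r - r / 2 = r / 2); last by field.
  by rewrite powRN mulVf ?mul1r// gt_eqF// powR_gt0.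
have -> : (r / 2) `^ (c - s) = r `^ (c - s) * 2 `^ (s - c).
  rewrite powRM ?invr_ge0 ?ltW//; congr (_ * _).
  by rewrite -powR_inv1// -powRrM; congr (_ `^ _); ring.
have -> : r `^ (c - s - 1) = r `^ (c - s) / r.
  by rewrite (@powRB _ r (c - s) 1) ?(gt_eqF r0) ?implybT// powRr1 ?ltW.
rewrite mulrBr -addrA lerD//.
set A := r `^ _; set B := 2 `^ _.
rewrite le_eqVlt; apply/orP; left; apply/eqP; field.
by rewrite !gt_eqF.
Qed.

End power_convolution.

(** * Integrals of a power times exp(-w / (2 t)) *)

Section power_exponential.
Context {R : realType}.
Local Notation mu := (@lebesgue_measure R).

(** Moves the domain into the integrand as a cut-off, since substitutions and Tonelli's theorem are
    applied on the whole line. *)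
Lemma integral_itv_if (i : interval R) (f : R -> R) :
  (\int[mu]_t (if t \in i then f t else 0)%:E = \int[mu]_(t in [set` i]) (f t)%:E)%E.
Proof.
rewrite [RHS]integral_mkcond; apply: eq_integral => t _.
by rewrite patchE mem_setE; case: ifP.
Qed.

Lemma measurable_itv_if d (T : measurableType d) (i : interval R) (g f : T -> R) :
  measurable_fun setT g -> measurable_fun setT f ->
  measurable_fun setT (fun p => if g p \in i then f p else 0).
Proof.
move=> mg mf; apply: measurable_fun_ifT => //.
apply: (measurable_fun_bool true) => //.
rewrite setTI -[X in measurable X]setTI.
exact: (mg _ [set` i]).
Qed.

Definition powexp (b w t : R) : R := t `^ (- 1 - b) * expR (- (w / (2 * t))).

Lemma powexp_ge0 b w t : 0 <= powexp b w t.
Proof. by rewrite mulr_ge0 ?powR_ge0 ?expR_ge0. Qed.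

Lemma measurable_powexp b w : measurable_fun [set: R] (powexp b w).
Proof.
apply: measurable_funM => //; apply: measurableT_comp => //.
apply: measurableT_comp => //; apply: measurable_funM => //.
by apply: (measurableT_comp measurable_invr); exact: measurable_funM.
Qed.

(** For positive [b] and [w] the substitution [u = w / (2 t)] shows that this is
    [2^b Gamma(b) w^(-b)]. What enters below is the homogeneity in [w] and that the constant is
    positive and finite. *)
Definition powexp_integral (b w : R) : \bar R :=
  (\int[mu]_(t in `]0%R, +oo[) (powexp b w t)%:E)%E.

(** The dilation of [t] by [w] removes [w] from the exponential and brings out [w * w^(-1-b)]. *)
Lemma powexp_integral_scale b w : 0 < w ->
  powexp_integral b w = ((w `^ (- b))%:E * powexp_integral b 1)%E.
Proof.
move=> w0; rewrite /powexp_integral -!integral_itv_if.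
have mi v : measurable_fun [set: R]
    (fun t => (if t \in `]0, +oo[ then powexp b v t else 0)%:E).
  by apply/measurable_EFinP; apply: measurable_itv_if => //; exact: measurable_powexp.
have i0 v t : (0 <= (if t \in `]0%R, +oo[ then powexp b v t else 0)%:E)%E.
  by rewrite lee_fin; case: ifP => // _; exact: powexp_ge0.
rewrite -(ge0_integral_dilate w0)// -ge0_integralZl//=; last 2 first.
- apply: (measurableT_comp (mi w)); exact: measurable_funM.
- by rewrite lee_fin ltW.
rewrite -ge0_integralZl//=; last 2 first.
- exact: mi.
- by rewrite lee_fin powR_ge0.
apply: eq_integral => t _; rewrite !in_itv/= !andbT pmulr_rgt0//.
case: ifPn => [t0|_]; last by rewrite !mule0.
rewrite -!EFinM; congr EFin.
have -> : w `^ (- b) = w * w `^ (- 1 - b).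
  rewrite -[X in X * _](powRr1 (ltW w0)) -powRD; last by rewrite (gt_eqF w0) implybT.
  by congr (_ `^ _); ring.
rewrite /powexp (powRM _ (ltW w0) (ltW t0)).
have -> : w / (2 * (w * t)) = 1 / (2 * t) by field; rewrite !gt_eqF.
by rewrite -!mulrA.
Qed.

Lemma mulr_expRN_le1 (x : R) : x * expR (- x) <= 1.
Proof.
rewrite expRN ler_pdivrMr ?expR_gt0// mul1r.
by rewrite (le_trans _ (expR_ge1Dx x))// lerDr.
Qed.

(** With [x = 1 / (2 (1 + b) t)] the left side is [(2 (1 + b) x exp(-x))^(1+b)], and [x exp(-x)] is
    at most 1. *)
Lemma powexp_le_const b t : 0 < b -> 0 < t ->
  powexp b 1 t <= (2 * (1 + b)) `^ (1 + b).
Proof.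
move=> b0 t0; have c0 : 0 < 1 + b by rewrite addr_gt0.
have -> : powexp b 1 t = (t^-1 * expR (- (2 * (1 + b) * t)^-1)) `^ (1 + b).
  rewrite powRM ?invr_ge0 ?expR_ge0 ?(ltW t0)// -expRM -powR_inv1 ?(ltW t0)//.
  rewrite -powRrM /powexp; congr (_ `^ _ * expR _); first by ring.
  by field; rewrite !gt_eqF.
apply: powR_le_base; rewrite ?mulr_ge0 ?invr_ge0 ?expR_ge0 ?(ltW t0) ?(ltW c0)//.
rewrite -[leRHS]mulr1 -ler_pdivrMl ?mulr_gt0// mulrA -invfM.
exact: mulr_expRN_le1.
Qed.

Lemma powexp_integral_lty b : 0 < b -> (powexp_integral b 1 < +oo)%E.
Proof.
move=> b0; rewrite /powexp_integral.
have mp (D : set R) : measurable D ->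
    measurable_fun D (fun t => (powexp b 1 t)%:E).
  by move=> mD; apply: measurable_funTS; apply/measurable_EFinP; exact: measurable_powexp.
rewrite (@itv_bndbnd_setU _ _ _ (BLeft 1)) ?bnd_simp//.
rewrite ge0_integral_setU//=; last 3 first.
- by apply: mp; exact: measurableU.
- by move=> t _; rewrite lee_fin powexp_ge0.
- apply/disj_setPS => t /= []; rewrite !in_itv/= => /andP[_ h]; rewrite andbT => h'; lra.
apply: lte_add_pinfty.
- apply: (@le_lt_trans _ _ (\int[mu]_(t in `]0%R, 1%R[) ((2 * (1 + b)) `^ (1 + b))%:E)%E).
    apply: ge0_le_integral => //.
    - by move=> t _; rewrite lee_fin powexp_ge0.
    - exact: mp.
    by move=> t /=; rewrite in_itv/= lee_fin => /andP[t0 _]; exact: powexp_le_const.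
  by rewrite integral_cst//= lebesgue_measure_itv/= lte_fin ltr01 sube0 mule1 ltry.
- apply: (@le_lt_trans _ _ (\int[mu]_(t in `[1%R, +oo[) (t `^ (- 1 - b))%:E)%E).
    apply: ge0_le_integral => //.
    - by move=> t _; rewrite lee_fin powexp_ge0.
    - exact: mp.
    - by apply: measurable_funTS; apply/measurable_EFinP.
    move=> t /=; rewrite in_itv/= andbT lee_fin => t1.
    rewrite ler_piMr ?powR_ge0// -[leRHS]expR0 ler_expR oppr_le0 divr_ge0//.
    by rewrite mulr_ge0// (le_trans _ t1).
  by rewrite integral_powRy// ltry.
Qed.

(** On [w, +oo[ the exponential is at least exp(-1/2), and the remaining power has an explicit
    integral. *)
Lemma powexp_integral_ge b w e : 0 < b -> 0 < w -> e <= w ->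
  ((expR (- (1 / 2)) * (w `^ (- b) / b))%:E <=
   \int[mu]_(t in `[e, +oo[) (powexp b w t)%:E)%E.
Proof.
move=> b0 w0 ew; rewrite EFinM -integral_powRy// -ge0_integralZl//=; last 2 first.
- by apply: measurable_funTS; apply/measurable_EFinP.
- by move=> t _; rewrite lee_fin powR_ge0.
have mp (D : set R) : measurable D ->
    measurable_fun D (fun t => (powexp b w t)%:E).
  by move=> mD; apply: measurable_funTS; apply/measurable_EFinP; exact: measurable_powexp.
apply: (@le_trans _ _ (\int[mu]_(t in `[w, +oo[) (powexp b w t)%:E)%E); last first.
  apply: ge0_subset_integral => //; first exact: mp.
  - by move=> t _; rewrite lee_fin powexp_ge0.
  - by move=> t /=; rewrite !in_itv/= !andbT; exact: le_trans.
apply: ge0_le_integral => //.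
- by move=> t _; rewrite mule_ge0// lee_fin ?powR_ge0 ?expR_ge0.
- apply: emeasurable_funM => //.
  by apply: measurable_funTS; apply/measurable_EFinP.
- exact: mp.
move=> t /=; rewrite in_itv/= andbT => wt.
rewrite -EFinM lee_fin mulrC ler_wpM2l ?powR_ge0// ler_expR lerN2.
have t0 := lt_le_trans w0 wt.
by rewrite ler_pdivrMr ?mulr_gt0//; lra.
Qed.

Lemma powexp_integral_gt0 b : 0 < b -> (0 < powexp_integral b 1)%E.
Proof.
move=> b0.
apply: (@lt_le_trans _ _ (\int[mu]_(t in `[1%R, +oo[) (powexp b 1 t)%:E)%E).
  apply: lt_le_trans (powexp_integral_ge b0 ltr01 (lexx 1)).
  by rewrite lte_fin mulr_gt0 ?expR_gt0// divr_gt0// powR_gt0.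
apply: ge0_subset_integral => //.
- by apply: measurable_funTS; apply/measurable_EFinP; exact: measurable_powexp.
- by move=> t _; rewrite lee_fin powexp_ge0.
- by move=> t /=; rewrite !in_itv/= !andbT; exact: lt_le_trans.
Qed.

End power_exponential.

(** * Heat kernel representation of the bubble *)

Section bubble_heat.
Context {R : realType}.
Local Notation mu := (@lebesgue_measure R).
Variable n : nat.
Local Notation rV := 'rV[R]_n.
Local Notation leb := (lebesgue_rV R n).
Local Notation twopi := ((2 * pi) `^ (- (n%:R / 2)) : R).

Lemma tonelli_rV_real (f : rV -> R -> R) :
  measurable_fun [set: rV * R] (fun p => f p.1 p.2) -> (forall z t, 0 <= f z t) ->
  (\int[leb]_z \int[mu]_t (f z t)%:E = \int[mu]_t \int[leb]_z (f z t)%:E)%E.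
Proof.
move=> mf f0.
apply: (@fubini_tonelli _ _ rV (measurableTypeR R) R leb mu (fun p => (f p.1 p.2)%:E)).
- by apply/measurable_EFinP.
- by move=> p; rewrite lee_fin.
Qed.

Lemma tonelli_real_real (f : R -> R -> R) :
  measurable_fun [set: R * R] (fun p => f p.1 p.2) -> (forall z t, 0 <= f z t) ->
  (\int[mu]_z \int[mu]_t (f z t)%:E = \int[mu]_t \int[mu]_z (f z t)%:E)%E.
Proof.
move=> mf f0.
apply: (@fubini_tonelli _ _ (measurableTypeR R) (measurableTypeR R) R mu mu
  (fun p => (f p.1 p.2)%:E)).
- by apply/measurable_EFinP.
- by move=> p; rewrite lee_fin.
Qed.

Definition bubble (b : R) (x : rV) : R := (1 + sqnorm x) `^ (- b).

Lemma sqnorm1_gt0 (x : rV) : 0 < 1 + sqnorm x.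
Proof. by rewrite ltr_pwDl// sqnorm_ge0. Qed.

Lemma bubble_gt0 b x : 0 < bubble b x.
Proof. by rewrite powR_gt0// sqnorm1_gt0. Qed.

Lemma bubble_ge0 b x : 0 <= bubble b x.
Proof. exact: powR_ge0. Qed.

Lemma measurable_bubble b : measurable_fun [set: rV] (bubble b).
Proof.
apply: (measurableT_comp (measurable_powR (- b))).
by apply: measurable_funD => //; exact: measurable_sqnorm.
Qed.

Lemma twopi_gt0 : 0 < twopi.
Proof. by rewrite powR_gt0// mulr_gt0// pi_gt0. Qed.

Lemma heat_powexp c t (x : rV) : 0 < t ->
  t `^ (c - 1) * heat t x = twopi * powexp (n%:R / 2 - c) (sqnorm x) t.
Proof.
move=> t0; rewrite /heat /powexp powRM ?(ltW t0) ?mulr_ge0 ?pi_ge0//.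
have -> : - 1 - (n%:R / 2 - c) = (c - 1) + - (n%:R / 2) by ring.
by rewrite (@powRD _ t (c - 1)) ?(gt_eqF t0) ?implybT//; ring.
Qed.

(** The factor exp(-1/(2t)) adds 1 to the squared norm in the Gaussian exponent; this is the origin
    of [1 + |x|^2] in the bubble. *)
Lemma heat_powexp1 c t (x : rV) : 0 < t ->
  t `^ (c - 1) * expR (- (1 / (2 * t))) * heat t x =
  twopi * powexp (n%:R / 2 - c) (1 + sqnorm x) t.
Proof.
move=> t0; rewrite mulrAC heat_powexp// /powexp -!mulrA; congr (_ * (_ * _)).
by rewrite -expRD; congr expR; field; rewrite gt_eqF.
Qed.

(** The weight [m] of the overview, with [c] for [a], extended by 0 so that it can be translated
    along the whole line. *)
Definition bubble_weight (c t : R) : R :=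
  if t \in `]0, +oo[ then t `^ (c - 1) * expR (- (1 / (2 * t))) else 0.

Lemma bubble_weight_ge0 c t : 0 <= bubble_weight c t.
Proof.
rewrite /bubble_weight; case: ifP => // _.
by rewrite mulr_ge0 ?powR_ge0 ?expR_ge0.
Qed.

Lemma measurable_powexp1 c :
  measurable_fun [set: R] (fun t : R => t `^ (c - 1) * expR (- (1 / (2 * t)))).
Proof.
apply: measurable_funM => //.
apply: measurableT_comp => //; apply: measurableT_comp => //.
apply: measurable_funM => //.
by apply: (measurableT_comp measurable_invr); exact: measurable_funM.
Qed.

Lemma measurable_bubble_weight c : measurable_fun [set: R] (bubble_weight c).
Proof. by apply: measurable_itv_if => //; exact: measurable_powexp1. Qed.

(** For the exponent [n/2 - b] the integrand is a multiple of [powexp b (1 + |x|^2)], so homogeneity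
    produces the power of [1 + |x|^2]. *)
Lemma bubble_heat_integral b x : 0 < b ->
  (\int[mu]_t (bubble_weight (n%:R / 2 - b) t * heat t x)%:E =
   (twopi * fine (powexp_integral b 1) * bubble b x)%:E)%E.
Proof.
move=> b0.
have fin : powexp_integral b 1 \is a fin_num.
  by rewrite gt0_fin_numE ?powexp_integral_lty// powexp_integral_gt0.
have -> : ((twopi * fine (powexp_integral b 1) * bubble b x)%:E =
    twopi%:E * ((bubble b x)%:E * powexp_integral b 1))%E.
  by rewrite -[in RHS](fineK fin) -!EFinM; congr EFin; ring.
rewrite /bubble -powexp_integral_scale ?sqnorm1_gt0//.
rewrite /powexp_integral -integral_itv_if -ge0_integralZl//=; last 3 first.
- apply/measurable_EFinP; apply: measurable_itv_if => //; exact: measurable_powexp.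
- by move=> t _; rewrite lee_fin; case: ifP => // _; exact: powexp_ge0.
- by rewrite lee_fin ltW// twopi_gt0.
apply: eq_integral => t _; rewrite /bubble_weight !in_itv/= andbT.
case: ifPn => [t0|_]; last by rewrite mul0r mule0.
by rewrite heat_powexp1// EFinM; congr (_ * (powexp _ _ _)%:E)%E; ring.
Qed.

Definition tail_weight (s e t : R) : R :=
  if t \in `[e, +oo[ then t `^ (- 1 - s) else 0.

Lemma tail_weight_ge0 s e t : 0 <= tail_weight s e t.
Proof. by rewrite /tail_weight; case: ifP => // _; rewrite powR_ge0. Qed.

Lemma measurable_tail_weight s e : measurable_fun [set: R] (tail_weight s e).
Proof. exact: measurable_itv_if. Qed.

(** The Riesz kernel in its heat representation, with the times below [e] removed. For [e > 0] it
    has finite mass, so the two terms of a difference can be integrated separately. *)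
Definition heat_tail (s e : R) (z : rV) : \bar R :=
  (\int[mu]_t (tail_weight s e t * heat t z)%:E)%E.

Lemma heat_tail_ge0 s e z : (0 <= heat_tail s e z)%E.
Proof.
apply: integral_ge0 => t _.
by rewrite lee_fin mulr_ge0 ?tail_weight_ge0 ?heat_ge0.
Qed.

Lemma measurable_tail_heat s e : measurable_fun [set: rV * R]
  (fun p => tail_weight s e p.2 * heat p.2 p.1).
Proof.
apply: measurable_funM.
  by apply: (measurableT_comp (measurable_tail_weight s e)); exact: measurable_snd.
exact: measurable_heat_swap.
Qed.

Lemma measurable_heat_tail s e : measurable_fun [set: rV] (heat_tail s e).
Proof.
have h := @measurable_fun_fubini_tonelli_F _ _ rV (measurableTypeR R) R mu
  (fun p : rV * R => (tail_weight s e p.2 * heat p.2 p.1)%:E).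
apply: h.
- by apply/measurable_EFinP; exact: measurable_tail_heat.
- by move=> p; rewrite lee_fin mulr_ge0 ?tail_weight_ge0 ?heat_ge0.
Qed.

(** Every heat kernel has mass 1, so only the time weight is left to integrate. *)
Lemma integral_heat_tail s e : 0 < s -> 0 < e ->
  (\int[leb]_z heat_tail s e z = (e `^ (- s) / s)%:E)%E.
Proof.
move=> s0 e0; rewrite -integral_powRy// -integral_itv_if.
rewrite (tonelli_rV_real (f := fun z t => tail_weight s e t * heat t z)).
- apply: eq_integral => t _.
  transitivity (\int[leb]_z ((tail_weight s e t)%:E * (heat t z)%:E))%E.
    by apply: eq_integral => z _; rewrite EFinM.
  rewrite ge0_integralZl//=.
  + rewrite /tail_weight in_itv/= andbT; case: ifPn => [et|_]; last by rewrite mul0e.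
    by rewrite integral_heat ?mule1// (lt_le_trans e0).
  + by apply/measurable_EFinP; exact: measurable_heatr.
  + by move=> z _; rewrite lee_fin heat_ge0.
  + by rewrite lee_fin tail_weight_ge0.
- exact: measurable_tail_heat.
- by move=> z t; rewrite mulr_ge0 ?tail_weight_ge0 ?heat_ge0.
Qed.

End bubble_heat.

(** * Convolution of the bubble with the truncated kernel *)

Section heat_tail_bubble.
Context {R : realType}.
Local Notation mu := (@lebesgue_measure R).
Variable n : nat.
Local Notation rV := 'rV[R]_n.
Local Notation leb := (lebesgue_rV R n).
Local Notation twopi := ((2 * pi) `^ (- (n%:R / 2)) : R).

Lemma ge0_integral_mull d (T : measurableType d) (m : {measure set T -> \bar R})
    (k : R) (f : T -> R) :
  measurable_fun [set: T] f -> (forall x, 0 <= f x) -> 0 <= k ->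
  (\int[m]_x (k * f x)%:E = k%:E * \int[m]_x (f x)%:E)%E.
Proof.
move=> mf f0 k0; rewrite -ge0_integralZl//=.
- by apply/measurable_EFinP.
- by move=> x _; rewrite lee_fin.
Qed.

Variables (s b e : R).
Hypotheses (s0 : 0 < s) (b0 : 0 < b) (sb : s < n%:R / 2 - b).
Hypotheses (e0 : 0 < e) (e1 : 2 * e < 1).
(** [c] is the exponent [a] of the overview, [A * bubble b] is the superposition of heat kernels
    with weight [M], and [kappa] is the constant of the gain in [power_convolution_le]. *)
Let c : R := n%:R / 2 - b.
Let k := tail_weight s e.
Let M := bubble_weight c.
Let A : R := twopi * fine (powexp_integral b 1).
Let kappa : R := (1 - 2 `^ (s - c)) / s.

Let mk : measurable_fun [set: R] k. Proof. exact: measurable_tail_weight. Qed.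
Let mM : measurable_fun [set: R] M. Proof. exact: measurable_bubble_weight. Qed.
Let k_ge0 t : 0 <= k t. Proof. exact: tail_weight_ge0. Qed.
Let M_ge0 t : 0 <= M t. Proof. exact: bubble_weight_ge0. Qed.

Let A_gt0 : 0 < A.
Proof.
rewrite mulr_gt0 ?twopi_gt0// fine_gt0// powexp_integral_gt0//=.
exact: powexp_integral_lty.
Qed.

Let kappa_gt0 : 0 < kappa.
Proof.
by rewrite divr_gt0// subr_gt0 powR2_lt1// subr_lt0.
Qed.

(* Semigroup property of the heat kernel, then the substitution [r = t + tau]. *)
Let heat_bubble (x : rV) (t : R) :
  (\int[leb]_z (k t * heat t z * (A * bubble b (x - z)))%:E =
   \int[mu]_r (k t * (M (r - t) * heat r x))%:E)%E.
Proof.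
have [t0|t0] := leP t 0.
  have -> : k t = 0.
    by rewrite /k /tail_weight in_itv/= andbT leNgt (le_lt_trans t0 e0).
  under eq_integral do rewrite !mul0r.
  by under [RHS]eq_integral do rewrite !mul0r; rewrite !integral0.
have mhr : measurable_fun [set: rV] (fun z => heat t z) by exact: measurable_heatr.
have mhx : measurable_fun [set: R * rV] (fun p => heat p.1 (x - p.2)).
  apply: (measurableT_comp (@measurable_heat R n)
    (_ : measurable_fun _ (fun p : R * rV => (p.1, x - p.2)))).
  apply/measurable_fun_pairP; split; first exact: measurable_fst.
  by apply: (measurableT_comp (measurable_rV_reflect x)); exact: measurable_snd.
have mhx1 tau : measurable_fun [set: rV] (fun z => heat tau (x - z)).
  exact: (measurable_fun_pair2 tau mhx).
have mhx2 y : measurable_fun [set: R] (fun tau => heat tau y).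
  exact: measurable_heatl.
transitivity (\int[leb]_z \int[mu]_tau
    (k t * (heat t z * (M tau * heat tau (x - z))))%:E)%E.
  apply: eq_integral => z _.
  rewrite EFinM -bubble_heat_integral// -ge0_integral_mull.
  - by apply: eq_integral => tau _; congr EFin; rewrite !mulrA.
  - by apply: measurable_funM => //; exact: mhx2.
  - by move=> tau; rewrite mulr_ge0 ?bubble_weight_ge0 ?heat_ge0.
  - by rewrite mulr_ge0// heat_ge0.
rewrite (tonelli_rV_real
  (f := fun z tau => k t * (heat t z * (M tau * heat tau (x - z))))); last 2 first.
- apply: measurable_funM => //; apply: measurable_funM.
    by apply: (measurableT_comp mhr); exact: measurable_fst.
  apply: measurable_funM.
    by apply: (measurableT_comp mM); exact: measurable_snd.
  apply: (measurableT_comp mhx (_ : measurable_fun _ (fun p : rV * R => (p.2, p.1)))).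
  by apply/measurable_fun_pairP; split; [exact: measurable_snd|exact: measurable_fst].
- move=> z tau; rewrite mulr_ge0//; apply: mulr_ge0; first exact: heat_ge0.
  by rewrite mulr_ge0// heat_ge0.
transitivity (\int[mu]_tau (k t * (M tau * heat (tau + t) x))%:E)%E.
  apply: eq_integral => tau _.
  have [tau0|tau0] := leP tau 0.
    have -> : M tau = 0.
      by rewrite /M /bubble_weight in_itv/= andbT ltNge tau0.
    under eq_integral do rewrite !(mul0r, mulr0).
    by rewrite integral0 !(mul0r, mulr0).
  transitivity (\int[leb]_z (k t * M tau * (heat t z * heat tau (x - z)))%:E)%E.
    by apply: eq_integral => z _; congr EFin; ring.
  rewrite ge0_integral_mull; last 3 first.
  - by apply: measurable_funM => //; exact: mhx1.
  - by move=> z; rewrite mulr_ge0 ?heat_ge0.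
  - by rewrite mulr_ge0.
  by rewrite heat_convolution// -EFinM mulrA addrC.
rewrite -[RHS](ge0_integral_translate t).
- by apply: eq_integral => tau _; rewrite addrK.
- apply/measurable_EFinP; apply: measurable_funM => //; apply: measurable_funM.
    by apply: (measurableT_comp mM); exact: measurable_funB.
  exact: mhx2.
- by move=> r; rewrite lee_fin mulr_ge0// mulr_ge0// heat_ge0.
Qed.

(** The gain is recorded only for [r >= 1]: as [2 * e < 1], it is available there for every
    admissible [e], and the final bound does not depend on [e]. *)
Let gain (x : rV) (r : R) : R :=
  if r \in `[1, +oo[ then
    kappa * (r `^ (c - s - 1) * expR (- (1 / (2 * r))) * heat r x) else 0.

(** The integrand lives on [e <= t < r]. There exp(-1/(2(r-t))) is at most exp(-1/(2r)), which
    leaves the integral of powers estimated in [power_convolution_le]. *)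
Let tail_gain (x : rV) (r : R) :
  (\int[mu]_t (k t * (M (r - t) * heat r x))%:E + (gain x r)%:E <=
   (e `^ (- s) / s * (M r * heat r x))%:E)%E.
Proof.
have [re|er] := leP r e.
  have r1 : r < 1.
    by apply: le_lt_trans re (le_lt_trans _ e1); rewrite mulr_natl mulr2n lerDl ltW.
  have -> : gain x r = 0 by rewrite /gain in_itv/= andbT leNgt r1.
  rewrite adde0; under eq_integral => t _.
    rewrite (_ : k t * _ = 0).
      over.
    rewrite /k /tail_weight /M /bubble_weight !in_itv/= !andbT.
    case: ifPn => [et|_]; last by rewrite mul0r.
    by rewrite subr_gt0 ltNge (le_trans re et)/= mul0r mulr0.
  by rewrite integral0 lee_fin !mulr_ge0 ?invr_ge0 ?powR_ge0 ?heat_ge0// ltW.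
have r0 : 0 < r by rewrite (lt_trans e0).
have sc : s < c by [].
pose E := expR (- (1 / (2 * r))) * heat r x.
have E0 : 0 <= E by rewrite mulr_ge0 ?expR_ge0 ?heat_ge0.
have mker : measurable_fun [set: R]
    (fun t => if t \in `[e, r[ then t `^ (- 1 - s) * (r - t) `^ (c - 1) else 0).
  apply: measurable_itv_if => //; apply: measurable_funM => //.
  by apply: (measurableT_comp (measurable_powR (c - 1))); exact: measurable_funB.
have ker0 t : 0 <= (if t \in `[e, r[ then t `^ (- 1 - s) * (r - t) `^ (c - 1) else 0).
  by case: ifP => // _; rewrite mulr_ge0 ?powR_ge0.
apply: (@le_trans _ _ ((E%:E * \int[mu]_t
    (if t \in `[e, r[ then t `^ (- 1 - s) * (r - t) `^ (c - 1) else 0)%:E) +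
    (gain x r)%:E)%E).
  rewrite leeD2r// -ge0_integral_mull//.
  apply: ge0_le_integral => //.
  - by move=> t _; rewrite lee_fin mulr_ge0// mulr_ge0// heat_ge0.
  - apply/measurable_EFinP; apply: measurable_funM => //; apply: measurable_funM => //.
    by apply: (measurableT_comp mM); exact: measurable_funB.
  - by apply/measurable_EFinP; apply: measurable_funM.
  move=> t _; rewrite lee_fin /k /tail_weight /M /bubble_weight !in_itv/= !andbT.
  have [et|] := leP e t; last by rewrite mul0r mulr0.
  rewrite /= subr_gt0; have [tr|_] := ltP t r; last by rewrite mul0r !mulr0.
  rewrite /E [leLHS](_ : _ = expR (- (1 / (2 * (r - t)))) *
    (t `^ (- 1 - s) * (r - t) `^ (c - 1) * heat r x)); last by ring.
  rewrite [leRHS](_ : _ = expR (- (1 / (2 * r))) *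
    (t `^ (- 1 - s) * (r - t) `^ (c - 1) * heat r x)); last by ring.
  apply: ler_wpM2r; first by rewrite !mulr_ge0 ?powR_ge0 ?heat_ge0.
  have t0 : 0 < t by rewrite (lt_le_trans e0).
  rewrite ler_expR lerN2 !div1r lef_pV2 ?posrE ?mulr_gt0 ?subr_gt0//.
  by rewrite ler_pM2l// gerBl ltW.
rewrite integral_itv_if.
apply: (@le_trans _ _ (E%:E * (r `^ (c - 1) * (e `^ (- s) / s) -
    (if 2 * e < r then kappa * r `^ (c - s - 1) else 0))%:E + (gain x r)%:E)%E).
  by rewrite leeD2r// lee_wpmul2l ?lee_fin//; exact: power_convolution_le.
rewrite -EFinM -EFinD lee_fin.
have -> : M r = r `^ (c - 1) * expR (- (1 / (2 * r))).
  by rewrite /M /bubble_weight in_itv/= r0.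
rewrite /gain in_itv/= andbT; have [r1|_] := leP 1 r.
  rewrite (lt_le_trans e1 r1) /E /= le_eqVlt; apply/orP; left; apply/eqP; ring.
(* For [r < 1] the gain that may be present is nonnegative and is dropped. *)
set g := if _ then _ else _.
have g0 : 0 <= g by rewrite /g; case: ifP => // _; rewrite mulr_ge0 ?powR_ge0// ltW.
rewrite addr0 -subr_ge0 [X in 0 <= X](_ : _ = E * g); last by rewrite /E; ring.
by rewrite mulr_ge0.
Qed.

Let gain_ge0 x r : 0 <= gain x r.
Proof.
rewrite /gain; case: ifP => // _.
by rewrite mulr_ge0 ?(ltW kappa_gt0)// mulr_ge0 ?heat_ge0// mulr_ge0 ?powR_ge0 ?expR_ge0.
Qed.

(** The exponent drops from [c] to [c - s = n/2 - (b + s)], so the gain represents a piece of the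
    bubble of exponent [b + s]. *)
Let gainE x r : gain x r = kappa * twopi *
  (if r \in `[1, +oo[ then powexp (b + s) (1 + sqnorm x) r else 0).
Proof.
rewrite /gain; case: ifPn => [|_]; last by rewrite mulr0.
rewrite in_itv/= andbT => r1.
rewrite heat_powexp1; last by rewrite (lt_le_trans ltr01).
by rewrite -mulrA; congr (_ * (_ * powexp _ _ _)); rewrite /c; ring.
Qed.

(** The right side is the mass of the truncated kernel times the bubble at [x]. So this bounds from
    below the integral of [bubble b x - bubble b (x - z)] against the kernel, arranged as a sum of
    nonnegative terms. *)
Lemma heat_tail_bubble_le (x : rV) :
  (\int[leb]_z (heat_tail s e z * (bubble b (x - z))%:E) +
     (kappa * twopi * (expR (- (1 / 2)) / (b + s)) / A * bubble (b + s) x)%:E <=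
   (e `^ (- s) / s * bubble b x)%:E)%E.
Proof.
have bs0 : 0 < b + s by rewrite addr_gt0.
have mb : measurable_fun [set: rV] (fun z => bubble b (x - z)).
  by apply: (measurableT_comp (measurable_bubble b)); exact: measurable_rV_reflect.
have mkh : measurable_fun [set: rV * R] (fun p => k p.2 * heat p.2 p.1).
  exact: measurable_tail_heat.
have kh0 z t : 0 <= k t * heat t z by rewrite mulr_ge0// heat_ge0.
have kp0 : 0 <= kappa * twopi.
  by rewrite mulr_ge0 ?(ltW kappa_gt0) ?(ltW (@twopi_gt0 R n)).
have Ab0 z : 0 <= A * bubble b z by rewrite mulr_ge0 ?bubble_ge0// ltW.
have mkMh : measurable_fun [set: R * R] (fun p => k p.1 * (M (p.2 - p.1) * heat p.2 x)).
  apply: measurable_funM; first by apply: (measurableT_comp mk); exact: measurable_fst.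
  apply: measurable_funM.
    apply: (measurableT_comp mM).
    by apply: measurable_funB; [exact: measurable_snd|exact: measurable_fst].
  by apply: (measurableT_comp (measurable_heatl x)); exact: measurable_snd.
have kMh0 t r : 0 <= k t * (M (r - t) * heat r x).
  by rewrite mulr_ge0// mulr_ge0// heat_ge0.
have mint : measurable_fun [set: R]
    (fun r => \int[mu]_t (k t * (M (r - t) * heat r x))%:E)%E.
  apply: (@measurable_fun_fubini_tonelli_G _ _ (measurableTypeR R)
    (measurableTypeR R) R mu (fun p => (k p.1 * (M (p.2 - p.1) * heat p.2 x))%:E)).
  - exact/measurable_EFinP.
  - by move=> p; rewrite lee_fin.
have mgain : measurable_fun [set: R] (gain x).
  apply: measurable_itv_if => //; apply: measurable_funM => //.
  apply: measurable_funM; last exact: measurable_heatl.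
  exact: measurable_powexp1.
(* Tonelli's theorem twice: first [z] is exchanged with [t], [heat_bubble] turns the integral in [z]
   into one in [r], then [r] is exchanged with [t]. *)
have step : (A%:E * \int[leb]_z (heat_tail s e z * (bubble b (x - z))%:E) =
    \int[mu]_r \int[mu]_t (k t * (M (r - t) * heat r x))%:E)%E.
  rewrite -ge0_integralZl//=; last 3 first.
  - apply: emeasurable_funM; first exact: measurable_heat_tail.
    exact/measurable_EFinP.
  - by move=> z _; rewrite mule_ge0 ?heat_tail_ge0// lee_fin bubble_ge0.
  - by rewrite lee_fin ltW.
  transitivity (\int[leb]_z \int[mu]_t (k t * heat t z * (A * bubble b (x - z)))%:E)%E.
    apply: eq_integral => z _.
    rewrite muleCA -EFinM -ge0_integralZr//=.
    - by apply/measurable_EFinP; apply: measurable_funM => //; exact: measurable_heatl.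
    - by move=> t _; rewrite lee_fin.
    - by rewrite lee_fin.
  rewrite (tonelli_rV_real (f := fun z t => k t * heat t z * (A * bubble b (x - z)))).
  - rewrite -(tonelli_real_real (f := fun t r => k t * (M (r - t) * heat r x)))//.
    by apply: eq_integral => t _; exact: heat_bubble.
  - apply: measurable_funM => //; apply: measurable_funM => //.
    by apply: (measurableT_comp mb); exact: measurable_fst.
  - by move=> z t; rewrite mulr_ge0.
rewrite -(@lee_pmul2l _ A%:E)// ?lte_fin// muleDr//; last first.
  rewrite ge0_adde_def// inE ?lee_fin.
    by apply: integral_ge0 => z _; rewrite mule_ge0 ?heat_tail_ge0// lee_fin bubble_ge0.
  rewrite mulr_ge0 ?bubble_ge0// divr_ge0 ?(ltW A_gt0)// mulr_ge0//.
  by rewrite divr_ge0 ?expR_ge0 ?(ltW bs0).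
rewrite step -!EFinM.
apply: (@le_trans _ _ (\int[mu]_r \int[mu]_t (k t * (M (r - t) * heat r x))%:E +
    \int[mu]_r (gain x r)%:E)%E).
  rewrite leeD2l//; under eq_integral do rewrite gainE.
  rewrite ge0_integral_mull; last 3 first.
  - by apply: measurable_itv_if => //; exact: measurable_powexp.
  - by move=> r; case: ifP => // _; exact: powexp_ge0.
  - exact: kp0.
  (* [powexp_integral_ge] applies with starting point 1, which is at most [1 + sqnorm x]. *)
  rewrite integral_itv_if [leLHS](_ : _ = ((kappa * twopi) *
    (expR (- (1 / 2)) * ((1 + sqnorm x) `^ (- (b + s)) / (b + s))))%:E).
    rewrite [leLHS]EFinM lee_wpmul2l ?lee_fin//.
    by apply: powexp_integral_ge => //; [exact: sqnorm1_gt0|rewrite lerDl sqnorm_ge0].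
  rewrite /bubble; congr EFin; move: (expR _) twopi (_ `^ (- (b + s))) kappa => X Y Z K.
  by field; rewrite !gt_eqF.
rewrite -ge0_integralD//=; last 3 first.
- by move=> r _; apply: integral_ge0 => t _; rewrite lee_fin.
- by move=> r _; rewrite lee_fin gain_ge0.
- exact/measurable_EFinP.
apply: (@le_trans _ _ (\int[mu]_r (e `^ (- s) / s * (M r * heat r x))%:E)%E).
  apply: ge0_le_integral => //.
  - move=> r _; apply: adde_ge0; last by rewrite lee_fin gain_ge0.
    by apply: integral_ge0 => t _; rewrite lee_fin.
  - by apply: emeasurable_funD => //; exact/measurable_EFinP.
  - apply/measurable_EFinP; apply: measurable_funM => //.
    by apply: measurable_funM => //; exact: measurable_heatl.
rewrite ge0_integral_mull; last 3 first.
- by apply: measurable_funM => //; exact: measurable_heatl.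
- by move=> r; rewrite mulr_ge0// heat_ge0.
- by rewrite divr_ge0 ?powR_ge0// ltW.
rewrite bubble_heat_integral// -EFinM lee_fin -/A.
by rewrite mulrCA.
Qed.

End heat_tail_bubble.

(** * The Riesz kernel *)

Section riesz_kernel.
Context {R : realType}.
Local Notation mu := (@lebesgue_measure R).
Variable n : nat.
Local Notation rV := 'rV[R]_n.
Local Notation leb := (lebesgue_rV R n).
Local Notation twopi := ((2 * pi) `^ (- (n%:R / 2)) : R).
Variable s : R.
Hypothesis s0 : 0 < s.

(* Equal to [0] at the origin. *)
Definition riesz (z : rV) : R := sqnorm z `^ (- (n%:R / 2 + s)).

Lemma riesz_ge0 z : 0 <= riesz z. Proof. exact: powR_ge0. Qed.

Lemma rieszN z : riesz (- z) = riesz z.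
Proof. by rewrite /riesz sqnormN. Qed.

Lemma measurable_riesz : measurable_fun [set: rV] riesz.
Proof. by apply: (measurableT_comp (measurable_powR _)); exact: measurable_sqnorm. Qed.

Lemma riesz_enorm z : (enorm z `^ (n%:R + 2 * s))^-1 = riesz z.
Proof.
rewrite /riesz powRN; congr _^-1; rewrite /enorm -powR12_sqrt ?sqnorm_ge0//.
by rewrite -powRrM /sqnorm; congr (_ `^ _); field.
Qed.

(** In closed form, [2^s Gamma(n/2 + s) / pi^(n/2)]. *)
Definition riesz_const : R := twopi * fine (powexp_integral (n%:R / 2 + s) 1).

Let ns0 : 0 < n%:R / 2 + s.
Proof. by rewrite ltr_wpDl// divr_ge0. Qed.

Let fin_powexp : powexp_integral (n%:R / 2 + s) 1 \is a fin_num.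
Proof. by rewrite gt0_fin_numE ?powexp_integral_lty// powexp_integral_gt0. Qed.

Lemma riesz_const_gt0 : 0 < riesz_const.
Proof.
rewrite mulr_gt0 ?twopi_gt0// fine_gt0// powexp_integral_gt0//=.
exact: powexp_integral_lty.
Qed.

Let heatE t (z : rV) : 0 < t ->
  t `^ (- 1 - s) * heat t z = twopi * powexp (n%:R / 2 + s) (sqnorm z) t.
Proof.
move=> t0; have -> : - 1 - s = - s - 1 by ring.
by rewrite heat_powexp// opprK.
Qed.

(** Homogeneity of [powexp_integral] in [w = |z|^2]. The origin is excluded because the integral
    diverges there, whereas [riesz] is 0. *)
Lemma riesz_heat z : z != 0 ->
  (\int[mu]_(t in `]0%R, +oo[) (t `^ (- 1 - s) * heat t z)%:E =
   (riesz_const * riesz z)%:E)%E.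
Proof.
move=> z0; have q0 : 0 < sqnorm z by rewrite lt_neqAle sqnorm_ge0 eq_sym sqnorm_eq0 z0.
have -> : ((riesz_const * riesz z)%:E =
    twopi%:E * ((riesz z)%:E * powexp_integral (n%:R / 2 + s) 1))%E.
  by rewrite -[in RHS](fineK fin_powexp) -!EFinM; congr EFin; rewrite /riesz_const; ring.
rewrite /riesz -powexp_integral_scale//.
rewrite /powexp_integral -!integral_itv_if -ge0_integral_mull; last 3 first.
- by apply: measurable_itv_if => //; exact: measurable_powexp.
- by move=> t; case: ifP => // _; exact: powexp_ge0.
- by rewrite ltW// twopi_gt0.
apply: eq_integral => t _; rewrite !in_itv/= andbT.
by case: ifPn => [t0|_]; [rewrite heatE|rewrite mulr0].
Qed.

Let measurable_th (z : rV) (D : set R) : measurable D ->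
  measurable_fun D (fun t => (t `^ (- 1 - s) * heat t z)%:E).
Proof.
move=> mD; apply: measurable_funTS; apply/measurable_EFinP.
by apply: measurable_funM => //; exact: measurable_heatl.
Qed.

Let th_ge0 (z : rV) t : 0 <= t `^ (- 1 - s) * heat t z.
Proof. by rewrite mulr_ge0 ?powR_ge0 ?heat_ge0. Qed.

Lemma heat_tailE e (z : rV) :
  heat_tail s e z = (\int[mu]_(t in `[e, +oo[) (t `^ (- 1 - s) * heat t z)%:E)%E.
Proof.
rewrite /heat_tail -integral_itv_if; apply: eq_integral => t _.
by rewrite /tail_weight; case: ifP => // _; rewrite mul0r.
Qed.

Lemma heat_tail_le e (z : rV) : 0 < e -> z != 0 ->
  (heat_tail s e z <= (riesz_const * riesz z)%:E)%E.
Proof.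
move=> e0 z0; rewrite -riesz_heat// heat_tailE.
apply: ge0_subset_integral => //; first exact: measurable_th.
- by move=> t _; rewrite lee_fin.
- by move=> t /=; rewrite !in_itv/= !andbT; exact: lt_le_trans.
Qed.

(** Bounding the Gaussian exponential by 1 leaves a power of [t] that is integrable away from 0;
    this includes [z = 0]. *)
Lemma heat_tail_fin_num e (z : rV) : 0 < e -> heat_tail s e z \is a fin_num.
Proof.
move=> e0; rewrite ge0_fin_numE ?heat_tail_ge0// heat_tailE.
apply: (@le_lt_trans _ _ (twopi%:E *
    \int[mu]_(t in `[e, +oo[) (t `^ (- 1 - (n%:R / 2 + s)))%:E)%E).
  rewrite -ge0_integralZl//=; last 3 first.
  - by apply: measurable_funTS; apply/measurable_EFinP.
  - by move=> t _; rewrite lee_fin powR_ge0.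
  - by rewrite lee_fin ltW// twopi_gt0.
  apply: ge0_le_integral => //.
  - by move=> t _; rewrite lee_fin.
  - by apply: measurable_th.
  - apply: emeasurable_funM => //.
    by apply: measurable_funTS; apply/measurable_EFinP.
  move=> t /=; rewrite in_itv/= andbT => et; have t0 := lt_le_trans e0 et.
  rewrite -EFinM lee_fin heatE// ler_wpM2l ?(ltW (twopi_gt0 _))//.
  rewrite ler_piMr ?powR_ge0// -[leRHS]expR0 ler_expR oppr_le0 divr_ge0 ?sqnorm_ge0//.
  by rewrite mulr_ge0// ltW.
by rewrite integral_powRy// -EFinM ltry.
Qed.

(** Monotone convergence along the times [e = 1 / (m + 3)]. The shift by 3 ensures [2 * e < 1] for
    all [m], as [heat_tail_bubble_le] demands. *)
Lemma heat_tail_cvg (z : rV) : z != 0 ->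
  heat_tail s (m.+3%:R^-1) z @[m --> \oo] --> (riesz_const * riesz z)%:E.
Proof.
move=> z0; rewrite -riesz_heat//.
have -> : `]0%R, +oo[%classic = \bigcup_m `[(m.+3%:R^-1 : R), +oo[%classic.
  apply/seteqP; split => t /=; rewrite in_itv/= ?andbT.
    move=> t0; exists (Num.truncn t^-1) => //=; rewrite in_itv/= andbT.
    rewrite invf_ple ?posrE// (@le_trans _ _ (Num.truncn t^-1).+1%:R)//.
      by rewrite ltW// truncnS_gt.
    by rewrite ler_nat; do 2 apply: leqW.
  by move=> [m _ /=]; rewrite in_itv/= andbT; apply: lt_le_trans; rewrite invr_gt0.
under eq_cvg do rewrite heat_tailE.
apply: ge0_nondecreasing_set_cvg_integral => //.
- move=> p q pq; rewrite subsetEset => t /=; rewrite !in_itv/= !andbT.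
  by apply: le_trans; rewrite lef_pV2 ?posrE// ler_nat !ltnS.
- by move=> i; exact: measurable_th.
- by move=> i t _; rewrite lee_fin.
Qed.

End riesz_kernel.

(** * Integrability of the Riesz kernel against min(1, |z|^2) *)

Section riesz_integrability.
Context {R : realType}.
Local Notation mu := (@lebesgue_measure R).

(** After the reflection [t -> 1 - t] the singularity sits at 1, and [power_convolution_le] applies
    on [1/2, 1[ with [c = 1 - s]. The auxiliary order [s'] only has to lie strictly between 0 and
    [1 - s]. *)
Lemma integral_powR_near0 (s : R) : 0 < s < 1 ->
  (\int[mu]_(t in `]0%R, (1 / 2)%R[) (t `^ (- s))%:E < +oo)%E.
Proof.
move=> /andP[s0 s1]; pose s' := (1 - s) / 2.
have s'0 : 0 < s' by rewrite divr_gt0// subr_gt0.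
have s'c : s' < 1 - s by rewrite /s'; lra.
rewrite -integral_itv_if -(ge0_integral_reflect 1); last 2 first.
- by apply/measurable_EFinP; apply: measurable_itv_if.
- by move=> t; rewrite lee_fin; case: ifP => // _; exact: powR_ge0.
have half0 : 0 < (1 / 2 : R) by [].
have half1 : (1 / 2 : R) < 1 by lra.
apply: le_lt_trans (le_lt_trans (power_convolution_le s'0 ltr01 s'c half0 half1) (ltry _)).
rewrite -integral_itv_if.
have m1 : measurable_fun [set: R] (fun t : R => (1 - t)) by exact: measurable_funB.
apply: ge0_le_integral => //.
- by move=> t _; rewrite lee_fin; case: ifP => // _; exact: powR_ge0.
- apply/measurable_EFinP; apply: measurable_itv_if => //.
  by apply: (measurableT_comp (measurable_powR _)).
- apply/measurable_EFinP; apply: measurable_itv_if => //; apply: measurable_funM => //.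
  by apply: (measurableT_comp (measurable_powR _)).
move=> t _; rewrite lee_fin; case: ifPn => [|_]; last first.
  by case: ifP => // _; rewrite mulr_ge0 ?powR_ge0.
rewrite in_itv/= => /andP[t1 t2].
have t0 : 0 < t by lra.
have -> : t \in `[(1 / 2)%R, 1[ by rewrite in_itv/=; apply/andP; split; lra.
have -> : 1 - s - 1 = - s by ring.
rewrite ler_peMl ?powR_ge0// (_ : - 1 - s' = - (1 + s')); last by ring.
rewrite powRN -[leLHS]invr1 lef_pV2 ?posrE ?powR_gt0//.
rewrite [leRHS](_ : 1 = 1 `^ (1 + s')); last by rewrite powR1.
by apply: powR_le_base; lra.
Qed.

Variable n : nat.
Local Notation rV := 'rV[R]_n.
Local Notation leb := (lebesgue_rV R n).

(** Half of the Gaussian exponent absorbs [|z|^2] through [x exp(-x) <= 1] with [x = |z|^2 / (4t)].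
    The other half is the heat kernel at time [2t], of mass 1, up to the factor [2^(n/2)]. *)
Lemma heat_second_moment (t : R) : 0 < t ->
  (\int[leb]_z (sqnorm z * heat t z)%:E <= (4 * 2 `^ (n%:R / 2) * t)%:E)%E.
Proof.
move=> t0; have t20 : 0 < 2 * t by rewrite mulr_gt0.
have C0 : 0 <= 4 * 2 `^ (n%:R / 2) * t by rewrite !mulr_ge0 ?powR_ge0// ltW.
rewrite -[leRHS]mule1 -(integral_heat n t20) -ge0_integral_mull//; last 2 first.
- exact: measurable_heatr.
- by move=> z; exact: heat_ge0.
apply: ge0_le_integral => //.
- by move=> z _; rewrite lee_fin mulr_ge0 ?sqnorm_ge0 ?heat_ge0.
- apply/measurable_EFinP; apply: measurable_funM; first exact: measurable_sqnorm.
  exact: measurable_heatr.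
- apply/measurable_EFinP; apply: measurable_funM => //; exact: measurable_heatr.
move=> z _; rewrite lee_fin /heat.
have pt0 : 0 <= 2 * pi * t by rewrite !mulr_ge0 ?pi_ge0// ltW.
have -> : 2 * pi * (2 * t) = 2 * (2 * pi * t) :> R by ring.
rewrite (@powRM _ 2)// (@powRN _ 2).
have h2 : 0 < 2 `^ (n%:R / 2) :> R by rewrite powR_gt0.
set Y := 2 `^ _; set P := (_ * t) `^ _; set q := sqnorm z.
have -> : expR (- (q / (2 * t))) = expR (- (q / (4 * t))) * expR (- (q / (4 * t))).
  by rewrite -expRD; congr expR; field; rewrite gt_eqF.
have -> : 2 * (2 * t) = 4 * t by ring.
set X := expR _.
have -> : q * (P * (X * X)) = (4 * t * P * X) * ((q / (4 * t)) * X).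
  by field; rewrite gt_eqF.
have -> : 4 * Y * t * (Y^-1 * P * X) = (4 * t * P * X) * 1.
  by field; rewrite gt_eqF.
by rewrite ler_wpM2l ?mulr_expRN_le1// !mulr_ge0 ?powR_ge0 ?expR_ge0// ltW.
Qed.

End riesz_integrability.

Section riesz_min.
Context {R : realType}.
Local Notation mu := (@lebesgue_measure R).
Variable n : nat.
Local Notation rV := 'rV[R]_n.
Local Notation leb := (lebesgue_rV R n).
Variable s : R.
Hypotheses (s0 : 0 < s) (s1 : s < 1).

Definition trunc_sqnorm (z : rV) : R := Num.min 1 (sqnorm z).

Lemma trunc_sqnorm_ge0 z : 0 <= trunc_sqnorm z.
Proof. by rewrite le_min ler01 sqnorm_ge0. Qed.

Lemma measurable_trunc_sqnorm : measurable_fun [set: rV] trunc_sqnorm.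
Proof. by apply: measurable_minr => //; exact: measurable_sqnorm. Qed.

Let C : R := 4 * 2 `^ (n%:R / 2).
Let C0 : 0 <= C. Proof. by rewrite mulr_ge0 ?powR_ge0. Qed.

(** Majorants for the contribution of time [t]: the second moment is used before 1/2 and the unit
    mass after it. They are integrable because [s < 1] and [s > 0], respectively. *)
Let near0 (t : R) : R := C * (if t \in `]0, (1 / 2)[ then t `^ (- s) else 0).
Let far (t : R) : R := if t \in `[(1 / 2), +oo[ then t `^ (- 1 - s) else 0.

Let near0_ge0 t : 0 <= near0 t.
Proof. by rewrite mulr_ge0//; case: ifP => // _; exact: powR_ge0. Qed.
Let far_ge0 t : 0 <= far t.
Proof. by rewrite /far; case: ifP => // _; exact: powR_ge0. Qed.
Let measurable_near0 : measurable_fun [set: R] near0.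
Proof. by apply: measurable_funM => //; exact: measurable_itv_if. Qed.
Let measurable_far : measurable_fun [set: R] far.
Proof. exact: measurable_itv_if. Qed.

Let weight_lty : (\int[mu]_t (near0 t + far t)%:E < +oo)%E.
Proof.
under eq_integral do rewrite EFinD.
rewrite ge0_integralD//=; last 4 first.
- by move=> t _; rewrite lee_fin.
- exact/measurable_EFinP.
- by move=> t _; rewrite lee_fin.
- exact/measurable_EFinP.
apply: lte_add_pinfty; last first.
  by rewrite integral_itv_if integral_powRy ?ltry.
rewrite ge0_integral_mull//; last 2 first.
- exact: measurable_itv_if.
- by move=> t; case: ifP => // _; exact: powR_ge0.
rewrite integral_itv_if lte_mul_pinfty ?lee_fin//.
by apply: integral_powR_near0; rewrite s0.
Qed.

Let inner_le t :
  (\int[leb]_z (trunc_sqnorm z *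
      (if t \in `]0, +oo[ then t `^ (- 1 - s) * heat t z else 0))%:E <=
   (near0 t + far t)%:E)%E.
Proof.
rewrite in_itv/= andbT; have [t0|t0] := ltP 0 t; last first.
  by rewrite integral0_eq ?lee_fin ?addr_ge0// => z _; rewrite mulr0.
have mt : measurable_fun [set: rV] (fun z => trunc_sqnorm z * heat t z).
  by apply: measurable_funM; [exact: measurable_trunc_sqnorm|exact: measurable_heatr].
have th0 (z : rV) : 0 <= trunc_sqnorm z * heat t z.
  by rewrite mulr_ge0 ?trunc_sqnorm_ge0 ?heat_ge0.
have -> : (\int[leb]_z (trunc_sqnorm z * (t `^ (- 1 - s) * heat t z))%:E =
    (t `^ (- 1 - s))%:E * \int[leb]_z (trunc_sqnorm z * heat t z)%:E)%E.
  rewrite -ge0_integral_mull ?powR_ge0//.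
  by apply: eq_integral => z _; rewrite mulrCA.
have [t2|t2] := ltP t (1 / 2).
  apply: (@le_trans _ _ (near0 t)%:E); last by rewrite lee_fin lerDl.
  apply: (@le_trans _ _ ((t `^ (- 1 - s))%:E * (C * t)%:E)%E).
    rewrite lee_wpmul2l ?lee_fin ?powR_ge0//.
    apply: le_trans (heat_second_moment n t0).
    apply: ge0_le_integral => //.
    - by move=> z _; rewrite lee_fin.
    - exact/measurable_EFinP.
    - apply/measurable_EFinP; apply: measurable_funM; first exact: measurable_sqnorm.
      exact: measurable_heatr.
    - by move=> z _; rewrite lee_fin ler_wpM2r ?heat_ge0// ge_min lexx orbT.
  rewrite -EFinM lee_fin /near0 in_itv/= t0 t2/= mulrCA ler_wpM2l//.
  rewrite -[X in _ * X]powRr1 ?(ltW t0)// -powRD ?(gt_eqF t0) ?implybT//.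
  by rewrite (_ : - 1 - s + 1 = - s)//; ring.
apply: (@le_trans _ _ (far t)%:E); last by rewrite lee_fin lerDr.
rewrite /far in_itv/= t2/= -[leRHS]mule1 lee_wpmul2l ?lee_fin ?powR_ge0//.
rewrite -(integral_heat n t0); apply: ge0_le_integral => //.
- by move=> z _; rewrite lee_fin.
- exact/measurable_EFinP.
- by apply/measurable_EFinP; exact: measurable_heatr.
- move=> z _; rewrite lee_fin -[leRHS]mul1r ler_wpM2r ?heat_ge0//.
  by rewrite ge_min lexx.
Qed.

(** The kernel is replaced by its heat representation and the integral in [z] is taken first, where
    [inner_le] applies. *)
Lemma riesz_trunc_lty : (\int[leb]_z (trunc_sqnorm z * riesz s z)%:E < +oo)%E.
Proof.
have K0 := riesz_const_gt0 n s0.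
have mr : measurable_fun [set: rV] (fun z => trunc_sqnorm z * riesz s z).
  by apply: measurable_funM; [exact: measurable_trunc_sqnorm|exact: measurable_riesz].
have r0 (z : rV) : 0 <= trunc_sqnorm z * riesz s z.
  by rewrite mulr_ge0 ?trunc_sqnorm_ge0 ?riesz_ge0.
pose g (z : rV) (t : R) : R := trunc_sqnorm z *
  (if t \in `]0, +oo[ then t `^ (- 1 - s) * heat t z else 0).
have g0 z t : 0 <= g z t.
  rewrite mulr_ge0 ?trunc_sqnorm_ge0//; case: ifP => // _.
  by rewrite mulr_ge0 ?powR_ge0 ?heat_ge0.
have mg : measurable_fun [set: rV * R] (fun p => g p.1 p.2).
  apply: measurable_funM.
    by apply: (measurableT_comp measurable_trunc_sqnorm); exact: measurable_fst.
  apply: measurable_itv_if; first exact: measurable_snd.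
  apply: measurable_funM.
    by apply: (measurableT_comp (measurable_powR _)); exact: measurable_snd.
  exact: measurable_heat_swap.
have mG : measurable_fun [set: rV] (fun z => \int[mu]_t (g z t)%:E)%E.
  apply: (@measurable_fun_fubini_tonelli_F _ _ rV (measurableTypeR R) R mu
    (fun p => (g p.1 p.2)%:E)).
  - exact/measurable_EFinP.
  - by move=> p; rewrite lee_fin.
have mH : measurable_fun [set: R] (fun t => \int[leb]_z (g z t)%:E)%E.
  apply: (@measurable_fun_fubini_tonelli_G _ _ rV (measurableTypeR R) R leb
    (fun p => (g p.1 p.2)%:E)).
  - exact/measurable_EFinP.
  - by move=> p; rewrite lee_fin.
suff : ((riesz_const n s)%:E * \int[leb]_z (trunc_sqnorm z * riesz s z)%:E < +oo)%E.
  rewrite !ltey; apply: contra => /eqP ->.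
  by rewrite gt0_muley ?lte_fin.
rewrite -ge0_integral_mull ?(ltW K0)//.
apply: le_lt_trans weight_lty.
apply: (@le_trans _ _ (\int[leb]_z \int[mu]_t (g z t)%:E)%E).
  apply: ge0_le_integral => //.
  - by move=> z _; rewrite lee_fin mulr_ge0// ltW.
  - by apply/measurable_EFinP; apply: measurable_funM.
  move=> z _; have [->|z0] := eqVneq z 0.
    rewrite (_ : trunc_sqnorm 0 = 0); last first.
      by rewrite /trunc_sqnorm (eqP (_ : sqnorm 0 == 0)) ?sqnorm_eq0// min_r.
    rewrite mul0r mulr0; apply: integral_ge0 => t _; rewrite lee_fin.
    exact: g0.
  rewrite mulrCA EFinM -riesz_heat// -integral_itv_if -ge0_integral_mull.
  - by [].
  - apply: measurable_itv_if => //; apply: measurable_funM => //.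
    exact: measurable_heatl.
  - by move=> t; case: ifP => // _; rewrite mulr_ge0 ?powR_ge0 ?heat_ge0.
  - exact: trunc_sqnorm_ge0.
rewrite (tonelli_rV_real (f := g))//.
apply: ge0_le_integral => //.
- by move=> t _; apply: integral_ge0 => z _; rewrite lee_fin.
- by apply/measurable_EFinP; exact: measurable_funD.
- by move=> t _; exact: inner_le.
Qed.

Let decayE (z : rV) :
  1 / (1 + enorm z `^ (n%:R + 2 * s)) = (1 + (riesz s z)^-1)^-1.
Proof. by rewrite -riesz_enorm invrK div1r. Qed.

Lemma measurable_decay :
  measurable_fun [set: rV] (fun x => 1 / (1 + enorm x `^ (n%:R + 2 * s))).
Proof.
under eq_fun do rewrite decayE.
apply: (measurableT_comp measurable_invr); apply: measurable_funD => //.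
by apply: (measurableT_comp measurable_invr); exact: measurable_riesz.
Qed.

(** Outside the unit ball the weight is at most the Riesz kernel, inside it is at most 1. A
    Gaussian, whose integral is known, takes the place of the indicator of the ball. *)
Lemma integral_decay_lty :
  (\int[leb]_x (1 / (1 + enorm x `^ (n%:R + 2 * s)))%:E < +oo)%E.
Proof.
(* Normalized to be exp((1 - |z|^2) / 2), hence at least 1 on the unit ball. *)
pose G (z : rV) : R := (2 * pi) `^ (n%:R / 2) * expR (1 / 2) * heat 1 z.
have G0 z : 0 <= G z by rewrite mulr_ge0 ?heat_ge0// mulr_ge0 ?powR_ge0 ?expR_ge0.
have mG : measurable_fun [set: rV] G.
  by apply: measurable_funM => //; exact: measurable_heatr.
have mr : measurable_fun [set: rV] (fun z => trunc_sqnorm z * riesz s z).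
  by apply: measurable_funM; [exact: measurable_trunc_sqnorm|exact: measurable_riesz].
have r0 (z : rV) : 0 <= trunc_sqnorm z * riesz s z.
  by rewrite mulr_ge0 ?trunc_sqnorm_ge0 ?riesz_ge0.
apply: (@le_lt_trans _ _ (\int[leb]_z (trunc_sqnorm z * riesz s z + G z)%:E)%E).
  apply: ge0_le_integral => //.
  - move=> z _; rewrite lee_fin decayE invr_ge0 addr_ge0// invr_ge0 riesz_ge0//.
  - by apply/measurable_EFinP; exact: measurable_decay.
  - by apply/measurable_EFinP; apply: measurable_funD.
  move=> z _; rewrite lee_fin decayE.
  have [z1|z1] := ltP 1 (sqnorm z).
    apply: (@le_trans _ _ (trunc_sqnorm z * riesz s z)); last by rewrite lerDl.
    rewrite /trunc_sqnorm min_l ?(ltW z1)// mul1r.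
    have q0 : 0 < sqnorm z by rewrite (lt_trans _ z1).
    have rz0 : 0 < riesz s z by rewrite powR_gt0.
    by rewrite invf_ple ?posrE ?addr_gt0 ?invr_gt0// lerDr.
  apply: (@le_trans _ _ 1).
    rewrite -[leRHS]invr1 lef_pV2 ?posrE ?ltr_wpDr ?invr_ge0 ?riesz_ge0//.
    by rewrite lerDl invr_ge0 riesz_ge0.
  apply: (@le_trans _ _ (G z)); last by rewrite lerDr.
  rewrite /G /heat mulr1 powRN.
  have p0 : 0 < (2 * pi) `^ (n%:R / 2) :> R by rewrite powR_gt0// mulr_gt0// pi_gt0.
  rewrite mulrACA mulfV ?gt_eqF//.
  rewrite -expRD [leRHS]mul1r (le_trans _ (expR_ge1Dx _))// lerDl mulr1; lra.
under eq_integral do rewrite EFinD.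
rewrite ge0_integralD//=; last 4 first.
- by move=> t _; rewrite lee_fin.
- exact/measurable_EFinP.
- by move=> t _; rewrite lee_fin.
- exact/measurable_EFinP.
apply: lte_add_pinfty; first exact: riesz_trunc_lty.
rewrite ge0_integral_mull ?integral_heat ?mule1 ?ltry//.
- exact: measurable_heatr.
- by move=> z; exact: heat_ge0.
- by rewrite mulr_ge0 ?powR_ge0 ?expR_ge0.
Qed.

End riesz_min.

(** * Second differences of the bubble *)

Section second_difference.
Context {R : realType}.

(** The mean value theorem, phrased so as to cover both orders of [X] and [Y]; the bound on the
    distance from [xi] to [X] is what the Taylor estimate uses. *)
Lemma powRN_mean_value (b X Y : R) : 1 <= X -> 1 <= Y ->
  exists xi, [/\ 1 <= xi, `|xi - X| <= `|Y - X| &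
    Y `^ (- b) - X `^ (- b) = - b * xi `^ (- (b + 1)) * (Y - X)].
Proof.
have key (U V : R) : 1 <= U -> U <= V -> exists2 xi, U <= xi <= V &
    V `^ (- b) - U `^ (- b) = - b * xi `^ (- (b + 1)) * (V - U).
  move=> U1 UV.
  have d (t : R) : 1 <= t -> is_derive t 1 (fun x : R => x `^ (- b)) (- b * t `^ (- (b + 1))).
    move=> t1; have := is_derive1_powR (- b) (lt_le_trans ltr01 t1).
    by rewrite (_ : - b - 1 = - (b + 1))//; ring.
  have [||xi] := @MVT_segment R (fun x => x `^ (- b)) (fun t => - b * t `^ (- (b + 1))) U V UV.
  - move=> t; rewrite in_itv/= => /andP[Ut _].
    by apply: d; rewrite (le_trans U1)// ltW.
  - apply: continuous_in_subspaceT => t; rewrite inE/= in_itv/= => /andP[Ut _].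
    by apply: continuous_powR; rewrite (lt_le_trans ltr01)// (le_trans U1).
  by rewrite in_itv/= => UxiV; exists xi.
move=> X1 Y1; have [XY|YX] := leP X Y.
  have [xi /andP[Xxi xiY] E] := key X Y X1 XY.
  exists xi; split => //; first exact: le_trans Xxi.
  by rewrite !ger0_norm ?subr_ge0// lerD2r.
have [xi /andP[Yxi xiX] E] := key Y X Y1 (ltW YX).
exists xi; split; first exact: le_trans Yxi.
  by rewrite !ler0_norm ?subr_le0 ?(ltW YX)// lerN2 lerD2r.
by rewrite -opprB E -[in RHS]opprB mulrN.
Qed.

Lemma powRN_le1 (c x : R) : 0 <= c -> 1 <= x -> x `^ (- c) <= 1.
Proof.
move=> c0 x1; rewrite powRN invf_le1 ?powR_gt0 ?(lt_le_trans ltr01)//.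
rewrite [leLHS](_ : 1 = 1 `^ c); last by rewrite powR1.
exact: powR_le_base.
Qed.

(** The mean value theorem is used for exponent [b] between [X] and [Y], then for exponent [b + 1]
    between [X] and [xi]. On [1, +oo[ the remaining power is at most 1, so the constant is free of
    [X]. *)
Lemma powRN_taylor (b X Y : R) : 0 < b -> 1 <= X -> 1 <= Y ->
  `|Y `^ (- b) - X `^ (- b) + b * X `^ (- (b + 1)) * (Y - X)| <=
  b * (b + 1) * (Y - X) ^+ 2.
Proof.
move=> b0 X1 Y1.
have [xi [xi1 xiX ->]] := powRN_mean_value b X1 Y1.
have [y [y1 _ E]] := powRN_mean_value (b + 1) X1 xi1.
have b10 : 0 < b + 1 by rewrite addr_gt0.
have -> : - b * xi `^ (- (b + 1)) * (Y - X) + b * X `^ (- (b + 1)) * (Y - X) =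
  - b * (xi `^ (- (b + 1)) - X `^ (- (b + 1))) * (Y - X) by ring.
rewrite {}E !normrM !normrN (ger0_norm (ltW b0)) (ger0_norm (ltW b10)).
rewrite (ger0_norm (powR_ge0 _ _)) -real_normK ?num_real// expr2 !mulrA.
rewrite ler_wpM2r// -!mulrA ler_wpM2l ?(ltW b0)// ler_wpM2l ?(ltW b10)//.
rewrite (le_trans _ xiX)// ler_piMl//; apply: powRN_le1 => //.
by rewrite addr_ge0 ?(ltW b10).
Qed.

Variable n : nat.
Local Notation rV := 'rV[R]_n.

Definition dotp (x z : rV) : R := \sum_i x 0 i * z 0 i.

Lemma dotpN x z : dotp x (- z) = - dotp x z.
Proof. by rewrite /dotp -sumrN; apply: eq_bigr => i _; rewrite mxE mulrN. Qed.

Lemma sqnormD (x z : rV) : sqnorm (x + z) = sqnorm x + 2 * dotp x z + sqnorm z.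
Proof.
rewrite /sqnorm /dotp mulr_sumr -!big_split/=; apply: eq_bigr => i _.
by rewrite mxE; ring.
Qed.

(** Cauchy-Schwarz, by expanding the squared norm of [|z|^2 x - (x.z) z], which is nonnegative. *)
Lemma sqr_dotp_le x z : dotp x z ^+ 2 <= sqnorm x * sqnorm z.
Proof.
have [z0|z0] := eqVneq z 0.
  rewrite z0 /dotp big1 => [|i _]; last by rewrite mxE mulr0.
  by rewrite expr0n mulr_ge0 ?sqnorm_ge0.
have q0 : 0 < sqnorm z by rewrite lt_neqAle sqnorm_ge0 eq_sym sqnorm_eq0 z0.
rewrite -(ler_pM2l q0) -subr_ge0.
have <- : \sum_i (sqnorm z * x 0 i - dotp x z * z 0 i) ^+ 2 =
    sqnorm z * (sqnorm x * sqnorm z) - sqnorm z * dotp x z ^+ 2.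
  transitivity (\sum_i (sqnorm z ^+ 2 * x 0 i ^+ 2 +
      (- (2 * sqnorm z * dotp x z)) * (x 0 i * z 0 i) +
      dotp x z ^+ 2 * z 0 i ^+ 2)).
    by apply: eq_bigr => i _; ring.
  rewrite !big_split/= -!mulr_sumr -/(sqnorm x) -/(sqnorm z) -/(dotp x z); ring.
by apply: sumr_ge0 => i _; exact: sqr_ge0.
Qed.

Definition second_diff (b : R) (x z : rV) : R :=
  2 * bubble b x - bubble b (x + z) - bubble b (x - z).

Lemma bubble_le1 b (x : rV) : 0 <= b -> bubble b x <= 1.
Proof. by move=> b0; apply: powRN_le1 => //; rewrite lerDl sqnorm_ge0. Qed.

Lemma second_diff0 b x : second_diff b x 0 = 0.
Proof. by rewrite /second_diff addr0 subr0; ring. Qed.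

Lemma measurable_second_diff b x : measurable_fun [set: rV] (second_diff b x).
Proof.
have m1 : measurable_fun [set: rV] (fun z => bubble b (x - z)).
  by apply: (measurableT_comp (measurable_bubble b)); exact: measurable_rV_reflect.
apply: measurable_funB => //; apply: measurable_funB => //.
rewrite (_ : (fun z => bubble b (x + z)) = (fun z => bubble b (x - z)) \o (fun z => 0 - z)).
  by apply: measurableT_comp => //; exact: measurable_rV_reflect.
by apply/funext => z /=; rewrite sub0r opprK.
Qed.

(** For [|z| >= 1] the three values in [0, 1] give the bound 2. For [|z| < 1] the power is expanded
    at [1 + |x|^2] with increments [2 x.z + |z|^2] and [- 2 x.z + |z|^2]. *)
Lemma second_diff_le b x z : 0 < b ->
  `|second_diff b x z| <=
  (2 + 2 * b + b * (b + 1) * (8 * sqnorm x + 2)) * trunc_sqnorm z.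
Proof.
move=> b0; have bb0 : 0 <= b * (b + 1) by rewrite mulr_ge0 ?addr_ge0 ?ltW.
have b1 (y : rV) : 0 <= bubble b y <= 1 by rewrite bubble_ge0 bubble_le1// ltW.
have qx := sqnorm_ge0 x; have qz := sqnorm_ge0 z.
have c0 : 0 <= b * (b + 1) * (8 * sqnorm x + 2).
  by rewrite mulr_ge0// addr_ge0// mulr_ge0.
rewrite /trunc_sqnorm; have [z1|z1] := leP 1 (sqnorm z).
  rewrite mulr1 /second_diff.
  have /andP[u0 u1] := b1 x; have /andP[v0 v1] := b1 (x + z).
  have /andP[w0 w1] := b1 (x - z).
  apply: (@le_trans _ _ 2); last first.
    by rewrite -addrA lerDl addr_ge0// mulr_ge0// ltW.
  by rewrite ler_norml; apply/andP; split; lra.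
pose X := 1 + sqnorm x.
have X1 (y : rV) : 1 <= 1 + sqnorm y by rewrite lerDl sqnorm_ge0.
have hp := powRN_taylor b0 (X1 x) (X1 (x + z)).
have hm := powRN_taylor b0 (X1 x) (X1 (x - z)).
move: hp hm; rewrite !sqnormD dotpN sqnormN.
set p := dotp x z; set q := sqnorm z.
have -> : 1 + (sqnorm x + 2 * p + q) - (1 + sqnorm x) = 2 * p + q by ring.
have -> : 1 + (sqnorm x + 2 * - p + q) - (1 + sqnorm x) = - (2 * p) + q by ring.
move=> hp hm.
(* The terms linear in [p] cancel between the two translates; what is left is a multiple of [q] and
   two Taylor remainders. *)
have dE : second_diff b x z = 2 * b * X `^ (- (b + 1)) * q -
    ((1 + (sqnorm x + 2 * p + q)) `^ (- b) - X `^ (- b) +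
     b * X `^ (- (b + 1)) * (2 * p + q)) -
    ((1 + (sqnorm x + 2 * - p + q)) `^ (- b) - X `^ (- b) +
     b * X `^ (- (b + 1)) * (- (2 * p) + q)).
  rewrite /second_diff /bubble !sqnormD dotpN sqnormN -/p -/q -/X; ring.
rewrite dE; apply: le_trans (ler_normB _ _) _.
apply: le_trans (lerD (ler_normB _ _) hm) _.
apply: le_trans (lerD (lerD (lexx _) hp) (lexx _)) _.
have Xb : X `^ (- (b + 1)) <= 1.
  by apply: powRN_le1; [rewrite addr_ge0 ?ltW|exact: X1].
rewrite ger0_norm; last first.
  by rewrite mulr_ge0// mulr_ge0 ?powR_ge0// mulr_ge0// ltW.
have h1 : 2 * b * X `^ (- (b + 1)) * q <= 2 * b * q.
  by rewrite ler_wpM2r// ler_piMr// mulr_ge0// ltW.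
have cs : p ^+ 2 <= sqnorm x * q by exact: sqr_dotp_le.
have q2 : q ^+ 2 <= q by rewrite expr2 ler_piMl// ltW.
have h2 : b * (b + 1) * (2 * p + q) ^+ 2 + b * (b + 1) * (- (2 * p) + q) ^+ 2 <=
    b * (b + 1) * (8 * sqnorm x + 2) * q.
  rewrite -mulrDr -[leRHS]mulrA ler_wpM2l//.
  have -> : (2 * p + q) ^+ 2 + (- (2 * p) + q) ^+ 2 = 8 * p ^+ 2 + 2 * q ^+ 2 by ring.
  lra.
rewrite -addrA; apply: le_trans (lerD h1 h2) _.
by rewrite -mulrDl ler_wpM2r// lerD2r lerDr.
Qed.

End second_difference.

(** * The principal value *)

Section dominated_real.
Context d (T : measurableType d) (R : realType) (m : {measure set T -> \bar R}).

Lemma integrable_dominated (f g : T -> R) :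
  measurable_fun [set: T] f -> measurable_fun [set: T] g ->
  (forall x, `|f x| <= g x) -> (\int[m]_x (g x)%:E < +oo)%E ->
  m.-integrable [set: T] (EFin \o f).
Proof.
move=> mf mg fg gfin; apply/integrableP; split; first exact/measurable_EFinP.
apply: le_lt_trans gfin; apply: ge0_le_integral => //.
- by apply: measurableT_comp => //; exact/measurable_EFinP.
- exact/measurable_EFinP.
- by move=> x _ /=; rewrite lee_fin.
Qed.

Lemma Rintegral_dominated_cvg (f_ : nat -> T -> R) (f g : T -> R) :
  (forall k, measurable_fun [set: T] (f_ k)) -> measurable_fun [set: T] f ->
  measurable_fun [set: T] g -> (forall x, f_ k x @[k --> \oo] --> f x) ->
  (forall k x, `|f_ k x| <= g x) -> (\int[m]_x (g x)%:E < +oo)%E ->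
  \int[m]_x f_ k x @[k --> \oo] --> \int[m]_x f x.
Proof.
move=> mf_ mf mg f_f fg gfin.
have g0 x : `|g x| <= g x by rewrite ger0_norm// (le_trans _ (fg 0%N x)).
have f_fE x : (f_ k x)%:E @[k --> \oo] --> (f x)%:E.
  by apply: cvg_EFin; [exact: nearW|exact: f_f].
have [fi _ cv] := @dominated_convergence _ _ _ m _ measurableT
  (fun k x => (f_ k x)%:E) (fun x => (f x)%:E) (fun x => (g x)%:E)
  (fun k => (measurable_EFinP _ _).2 (mf_ k))
  ((measurable_EFinP _ _).2 mf)
  (aeW _ (fun x _ => f_fE x))
  (integrable_dominated mg mg g0 gfin)
  (aeW _ (fun x k _ => fg k x)).
apply: fine_cvg; rewrite fineK; first exact: cv.
by apply: integrable_fin_num.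
Qed.

End dominated_real.

(** * Reflection and symmetrization of signed integrals *)

Section signed_euclidean.
Context {R : realType}.
Variable n : nat.
Local Notation rV := 'rV[R]_n.
Local Notation leb := (lebesgue_rV R n).

Lemma Rintegral_rV_reflect (x : rV) (f : rV -> R) :
  measurable_fun [set: rV] f -> \int[leb]_z f (x - z) = \int[leb]_z f z.
Proof.
move=> mf; congr fine; rewrite [LHS]integralE [RHS]integralE.
have mf' : measurable_fun [set: rV] (fun z => (f z)%:E) by exact/measurable_EFinP.
congr (_ - _)%E.
- rewrite -[RHS](ge0_integral_rV_reflect x)//; last exact: measurable_funepos.
  apply: eq_integral => z _.
  exact: (congr1 (@^~ z) (funepos_comp (fun z => (f z)%:E) (fun z => x - z))).
- rewrite -[RHS](ge0_integral_rV_reflect x)//; last exact: measurable_funeneg.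
  apply: eq_integral => z _.
  exact: (congr1 (@^~ z) (funeneg_comp (fun z => (f z)%:E) (fun z => x - z))).
Qed.

(** The integral is averaged with that of the reflected function. Against an even kernel this
    exchanges first differences for second differences. *)
Lemma Rintegral_symmetrize (f : rV -> R) : leb.-integrable [set: rV] (EFin \o f) ->
  \int[leb]_z f z = \int[leb]_z (1 / 2 * (f z + f (- z))).
Proof.
move=> fi; have mf : measurable_fun [set: rV] f.
  by have /integrableP[/measurable_EFinP] := fi.
have mfN : measurable_fun [set: rV] (fun z => f (- z)).
  under eq_fun do rewrite -sub0r.
  by apply: (measurableT_comp mf); exact: measurable_rV_reflect.
have fiN : leb.-integrable [set: rV] (EFin \o (fun z => f (- z))).
  have /integrableP[mf' h] := fi.
  apply/integrableP; split; first exact/measurable_EFinP.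
  rewrite (ge0_integral_rV_opp (f := fun z => `|(f z)%:E|%E))//.
  by apply: measurableT_comp.
rewrite RintegralZl//; last first.
  by apply: (eq_integrable _ _ _ _ (integrableD measurableT fi fiN)).
rewrite RintegralD//.
have -> : \int[leb]_z f (- z) = \int[leb]_z f z.
  by rewrite -[RHS](Rintegral_rV_reflect 0)//; apply: eq_Rintegral => z _; rewrite sub0r.
by field.
Qed.

End signed_euclidean.

Section principal_value.
Context {R : realType}.
Variable n : nat.
Local Notation rV := 'rV[R]_n.
Local Notation leb := (lebesgue_rV R n).
Variables (s b : R).
Hypotheses (s0 : 0 < s) (s1 : s < 1) (b0 : 0 < b).
Variable x : rV.

Let u := bubble b : rV -> R.
Let D : R := 2 + 2 * b + b * (b + 1) * (8 * sqnorm x + 2).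
(** The symmetrized integrand of the principal value and, by [second_diff_le], an integrable
    majorant of it. *)
Let G (z : rV) : R := 1 / 2 * (second_diff b x z * riesz s z).
Let H (z : rV) : R := D * (trunc_sqnorm z * riesz s z).

Let D0 : 0 <= D.
Proof.
have q := sqnorm_ge0 x; rewrite /D.
by rewrite !addr_ge0// ?mulr_ge0// ?addr_ge0 ?mulr_ge0// ltW.
Qed.

Let mtr : measurable_fun [set: rV] (fun z => trunc_sqnorm z * riesz s z).
Proof.
by apply: measurable_funM; [exact: measurable_trunc_sqnorm|exact: measurable_riesz].
Qed.

Let tr0 (z : rV) : 0 <= trunc_sqnorm z * riesz s z.
Proof. by rewrite mulr_ge0 ?trunc_sqnorm_ge0 ?riesz_ge0. Qed.

Let mH : measurable_fun [set: rV] H.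
Proof. exact: measurable_funM. Qed.

Let mul_trunc_lty (k : R) : 0 <= k ->
  (\int[leb]_z (k * (trunc_sqnorm z * riesz s z))%:E < +oo)%E.
Proof.
move=> k0; rewrite ge0_integral_mull// lte_mul_pinfty ?lee_fin//.
exact: riesz_trunc_lty.
Qed.

Let mG : measurable_fun [set: rV] G.
Proof.
apply: measurable_funM => //; apply: measurable_funM.
  exact: measurable_second_diff.
exact: measurable_riesz.
Qed.

Let GH z : `|G z| <= H z.
Proof.
rewrite /G /H normrM [X in _ * X]normrM (ger0_norm (riesz_ge0 _ _)) mulrA mulrA.
rewrite ler_wpM2r ?riesz_ge0// (le_trans _ (second_diff_le x z b0))//.
have h0 : 0 <= 1 / 2 :> R by lra.
have h1 : 1 / 2 <= 1 :> R by lra.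
by rewrite (ger0_norm h0) ler_piMl.
Qed.

Let mu_x : measurable_fun [set: rV] (fun z => u (x - z)).
Proof.
by apply: (measurableT_comp (measurable_bubble b)); exact: measurable_rV_reflect.
Qed.

Let diff_le1 z : `|u x - u (x - z)| <= 1.
Proof.
have := bubble_ge0 b x; have := bubble_le1 x (ltW b0).
have := bubble_ge0 b (x - z); have := bubble_le1 (x - z) (ltW b0).
rewrite -/u => h1 h2 h3 h4.
by rewrite ler_norml; apply/andP; split; lra.
Qed.

Definition bubble_pv : R := \int[leb]_z G z.

Let enormE (z : rV) : enorm z = Num.sqrt (sqnorm z). Proof. by []. Qed.

Let measurable_far (e : R) (f : rV -> R) : measurable_fun [set: rV] f ->
  measurable_fun [set: rV] (fun z => if e <= enorm z then f z else 0).
Proof.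
move=> mf; apply: measurable_fun_ifT => //; apply: measurable_fun_ler => //.
rewrite (_ : @enorm R n = fun z => sqnorm z `^ 2^-1); last first.
  by apply/funext => z; rewrite enormE -powR12_sqrt ?sqnorm_ge0.
by apply: (measurableT_comp (measurable_powR _)); exact: measurable_sqnorm.
Qed.

Let far (e : R) (z : rV) : R :=
  if e <= enorm z then (u x - u (x - z)) * riesz s z else 0.

Let mfar e : measurable_fun [set: rV] (far e).
Proof.
apply: measurable_far; apply: measurable_funM; last exact: measurable_riesz.
exact: measurable_funB.
Qed.

(** The first difference is at most 1, and [trunc_sqnorm] is at least min(1, e^2) where
    [enorm z >= e]. *)
Let far_integrable e : 0 < e -> leb.-integrable [set: rV] (EFin \o far e).
Proof.
move=> e0; pose k := Num.min 1 (e ^+ 2).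
have k0 : 0 < k by rewrite lt_min ltr01 exprn_gt0.
apply: (@integrable_dominated _ _ _ _ _ (fun z => k^-1 * (trunc_sqnorm z * riesz s z))) => //.
- exact: measurable_funM.
- move=> z; rewrite /far; case: ifPn => ez; last first.
    by rewrite normr0 mulr_ge0// invr_ge0 ltW.
  rewrite normrM (ger0_norm (riesz_ge0 _ _)) mulrA ler_wpM2r ?riesz_ge0//.
  rewrite (le_trans (diff_le1 z))// ler_pdivlMl// mulr1.
  rewrite /k /trunc_sqnorm le_min !ge_min lexx/=.
  rewrite -[X in _ || (_ <= X)]sqr_sqrtr ?sqnorm_ge0// -enormE.
  by rewrite ler_pXn2r ?nnegrE ?ez ?orbT// ?(ltW e0)// enormE sqrtr_ge0.
- by apply: mul_trunc_lty; rewrite invr_ge0 ltW.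
Qed.

(** The substitution [z = x - y] followed by symmetrization over the even set [enorm z >= e]. *)
Let frac_lap_truncE k e : 0 < e ->
  frac_lap_trunc s (fun y => k * bubble b y) x e =
  k * \int[leb]_z (if e <= enorm z then G z else 0).
Proof.
move=> e0; rewrite /frac_lap_trunc Rintegral_mkcond.
transitivity (\int[leb]_y (k * far e (x - y))).
  apply: eq_Rintegral => y _; rewrite patchE /far subKr riesz_enorm.
  rewrite -mulrBr -mulrA (_ : (y \in _) = (e <= enorm (x - y))).
    by case: ifP => // _; rewrite mulr0.
  by apply/idP/idP; rewrite inE.
rewrite (Rintegral_rV_reflect x (f := fun z => k * far e z)); last exact: measurable_funM.
rewrite RintegralZl ?far_integrable// Rintegral_symmetrize ?far_integrable//.
congr (_ * _); apply: eq_Rintegral => z _; rewrite /far opprK rieszN.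
rewrite (_ : enorm (- z) = enorm z); last by rewrite !enormE sqnormN.
case: ifP => _; last by rewrite addr0 mulr0.
by rewrite /G /second_diff -/u; ring.
Qed.

Lemma frac_lap_trunc_bubble_cvg k :
  frac_lap_trunc s (fun y => k * bubble b y) x e @[e --> 0^'+] --> k * bubble_pv.
Proof.
(* The one-sided limit is tested on sequences, to which dominated convergence applies. *)
apply/cvg_at_rightP => e [e0 e_cvg].
rewrite (eq_cvg _ _ (fun j => frac_lap_truncE k (e0 j))); apply: cvgMl_tmp.
apply: (@Rintegral_dominated_cvg _ _ _ _ _ _ H) => //.
- by move=> j; exact: measurable_far.
- move=> z; have [->|z0] := eqVneq z 0.
    rewrite /G second_diff0 mul0r mulr0.
    by under eq_cvg do rewrite if_same; exact: cvg_cst.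
  have ez : 0 < enorm z.
    by rewrite enormE sqrtr_gt0 lt_neqAle sqnorm_ge0 eq_sym sqnorm_eq0 z0.
  (* Once the radius is below [enorm z] the truncation is no longer active at [z]. *)
  apply: (@cvg_trans _ (G z @[_ --> \oo])); last exact: cvg_cst.
  apply: near_eq_cvg; near=> j.
  rewrite ifT// (le_trans (ler_norm _))// -normrN -sub0r.
  by near: j; exact: ((cvgrPdist_le _ _).1 e_cvg _ ez).
- move=> j z; case: ifP => // _; rewrite normr0.
  exact: le_trans (GH z).
- exact: mul_trunc_lty.
Unshelve. all: by end_near. Qed.

Let K (k : nat) (z : rV) : R := fine (heat_tail s (k.+3%:R^-1) z).

Let inv0 k : 0 < k.+3%:R^-1 :> R. Proof. by rewrite invr_gt0. Qed.

Let KE k z : (K k z)%:E = heat_tail s (k.+3%:R^-1) z.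
Proof. by rewrite fineK// heat_tail_fin_num. Qed.

Let K_ge0 k z : 0 <= K k z.
Proof. by rewrite -lee_fin KE heat_tail_ge0. Qed.

Let mK k : measurable_fun [set: rV] (K k).
Proof.
apply/measurable_EFinP; rewrite (_ : EFin \o K k = heat_tail s (k.+3%:R^-1)).
  exact: measurable_heat_tail.
by apply/funext => z /=; exact: KE.
Qed.

Let KN k z : K k (- z) = K k z.
Proof.
by congr fine; apply: eq_integral => t _; rewrite heatN.
Qed.

(** The truncated kernels converge to [riesz_const] times the Riesz kernel and stay below it off the
    origin, where the second difference is 0; [riesz_const * H] dominates. *)
Let heat_cvg : \int[leb]_z (1 / 2 * (second_diff b x z * K k z)) @[k --> \oo] -->
  \int[leb]_z (riesz_const n s * G z).
Proof.
have rc0 := riesz_const_gt0 n s0.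
apply: (@Rintegral_dominated_cvg _ _ _ _ _ _ (fun z => riesz_const n s * H z)).
- move=> k; apply: measurable_funM => //; apply: measurable_funM => //.
  exact: measurable_second_diff.
- exact: measurable_funM.
- exact: measurable_funM.
- move=> z; have [->|z0] := eqVneq z 0.
    rewrite /G second_diff0 mul0r !mulr0.
    by under eq_cvg do rewrite mul0r mulr0; exact: cvg_cst.
  rewrite (_ : _ * G z = 1 / 2 * (second_diff b x z * (riesz_const n s * riesz s z))).
    apply: cvgMl_tmp; apply: cvgMl_tmp; apply: fine_cvg.
    exact: heat_tail_cvg.
  by rewrite /G; ring.
- move=> k z; have [->|z0] := eqVneq z 0.
    rewrite second_diff0 mul0r mulr0 normr0 mulr_ge0 ?(ltW rc0)//.
    exact: le_trans (GH 0).
  apply: (@le_trans _ _ `|riesz_const n s * G z|); last first.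
    by rewrite normrM (ger0_norm (ltW rc0)) ler_wpM2l// ltW.
  rewrite (_ : _ * G z = 1 / 2 * (second_diff b x z * (riesz_const n s * riesz s z))).
    rewrite !(normrM (1 / 2)) ler_wpM2l// !(normrM (second_diff b x z)) ler_wpM2l//.
    rewrite (ger0_norm (K_ge0 _ _)).
    rewrite ger0_norm; last by rewrite mulr_ge0 ?riesz_ge0// ltW.
    by rewrite -lee_fin KE heat_tail_le.
  by rewrite /G; ring.
- rewrite (eq_integral (fun z => (riesz_const n s * D * (trunc_sqnorm z * riesz s z))%:E)).
    by apply: mul_trunc_lty; rewrite mulr_ge0// ltW.
  by move=> z _; congr EFin; rewrite /H mulrA.
Qed.

Hypothesis sb : s < n%:R / 2 - b.

(** The constant of [heat_tail_bubble_le], with [kappa] and [A] written out. *)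
Definition bubble_gain : R :=
  (1 - 2 `^ (s - (n%:R / 2 - b))) / s * (2 * pi) `^ (- (n%:R / 2)) *
  (expR (- (1 / 2)) / (b + s)) /
  ((2 * pi) `^ (- (n%:R / 2)) * fine (powexp_integral b 1)).

(** [K k] is even and integrable, so the symmetrization can be undone and the difference split into
    two finite integrals; [heat_tail_bubble_le] compares them. *)
Let heat_ge k :
  bubble_gain * bubble (b + s) x <=
  \int[leb]_z (1 / 2 * (second_diff b x z * K k z)).
Proof.
set e : R := k.+3%:R^-1.
have e0 : 0 < e by exact: inv0.
have e1 : 2 * e < 1.
  by rewrite /e ltr_pdivrMr// mul1r ltr_nat.
have KI : (\int[leb]_z (K k z)%:E = (e `^ (- s) / s)%:E)%E.
  by under eq_integral do rewrite KE; rewrite integral_heat_tail.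
have Ki : leb.-integrable [set: rV] (EFin \o K k).
  apply: (@integrable_dominated _ _ _ _ _ (K k)) => //.
  - by move=> z; rewrite ger0_norm.
  - by rewrite KI ltry.
have uKi : leb.-integrable [set: rV] (EFin \o (fun z => u (x - z) * K k z)).
  apply: (@integrable_dominated _ _ _ _ _ (K k)) => //.
  - exact: measurable_funM.
  - move=> z; rewrite ger0_norm ?mulr_ge0 ?bubble_ge0//.
    by rewrite ler_piMl// bubble_le1// ltW.
  - by rewrite KI ltry.
have cKi : leb.-integrable [set: rV] (EFin \o (fun z => u x * K k z)).
  exact: (integrableZl measurableT (u x) Ki).
have fi : leb.-integrable [set: rV]
    (EFin \o (fun z => u x * K k z - u (x - z) * K k z)).
  exact: (integrableB measurableT cKi uKi).
have -> : \int[leb]_z (1 / 2 * (second_diff b x z * K k z)) =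
    \int[leb]_z (u x * K k z - u (x - z) * K k z).
  rewrite [RHS]Rintegral_symmetrize//; apply: eq_Rintegral => z _.
  by rewrite KN opprK /second_diff -/u; ring.
rewrite RintegralB// RintegralZl//.
have h := heat_tail_bubble_le s0 b0 sb e0 e1 x.
have E : ((\int[leb]_z (u (x - z) * K k z))%:E =
    \int[leb]_z (heat_tail s e z * (bubble b (x - z))%:E))%E.
  rewrite fineK; last exact: integrable_fin_num.
  by apply: eq_integral => z _; rewrite EFinM KE muleC.
have -> : \int[leb]_z K k z = e `^ (- s) / s by rewrite /Rintegral KI.
move: h; rewrite -E -EFinD lee_fin => h.
by rewrite lerBrDr addrC (mulrC (u x)).
Qed.

Lemma bubble_gain_gt0 : 0 < bubble_gain.
Proof.
have t0 := @twopi_gt0 R n.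
have f0 : 0 < fine (powexp_integral b 1).
  by rewrite fine_gt0// powexp_integral_gt0//= powexp_integral_lty.
have g0 : 0 < 1 - 2 `^ (s - (n%:R / 2 - b)) :> R by rewrite subr_gt0 powR2_lt1// subr_lt0.
rewrite /bubble_gain divr_gt0 ?(mulr_gt0 t0 f0)//.
by rewrite (mulr_gt0 (mulr_gt0 (divr_gt0 g0 s0) t0))// divr_gt0 ?expR_gt0 ?addr_gt0.
Qed.

(** The lower bound in [heat_ge] is the same for all [k], so it passes to the limit. *)
Lemma bubble_pv_ge : bubble_gain * bubble (b + s) x <= riesz_const n s * bubble_pv.
Proof.
have -> : riesz_const n s * bubble_pv = \int[leb]_z (riesz_const n s * G z).
  rewrite RintegralZl//; apply: (@integrable_dominated _ _ _ _ _ H) => //.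
  exact: mul_trunc_lty.
rewrite -(cvg_lim _ heat_cvg)//; apply: limr_ge.
  by apply/cvg_ex; eexists; exact: heat_cvg.
by apply: nearW => k; exact: heat_ge.
Qed.

End principal_value.

(** * Smoothness of the bubble *)

Section bubble_smooth.
Context {R : realType}.
Variable n : nat.
Local Notation rV := 'rV[R]_n.

(** Reduces directional derivatives to the calculus of one real variable. *)
Lemma is_derive_line (V : normedModType R) (f : V -> R) (x v : V) (d : R) :
  is_derive (0 : R) 1 (fun h => f (h *: v + x)) d -> is_derive x v f d.
Proof.
have E : (fun h : R => h^-1 *:
      (((fun k => f (k *: v + x)) \o shift 0) (h *: 1) - f (0 *: v + x))) =
    (fun h : R => h^-1 *: ((f \o shift x) (h *: v) - f x)).
  by apply/funext => h /=; rewrite addr0 scale0r add0r [h *: 1]mulr1.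
move=> [dh dE]; split.
  by move: dh; rewrite /derivable E.
by rewrite -dE /derive E.
Qed.

Lemma is_derive_coord (i j : 'I_n) (x : rV) :
  is_derive x (delta_mx 0 j) (fun y : rV => y 0 i) (i == j)%:R.
Proof.
apply: is_derive_line.
rewrite (_ : (fun _ => _) = (fun h : R => h * (i == j)%:R + x 0 i)); last first.
  by apply/funext => h; rewrite !mxE eqxx.
have h1 := is_derive_id (0 : R) 1.
have := is_deriveD (is_deriveM h1 (is_derive_cst ((i == j)%:R : R) (0 : R) 1))
  (is_derive_cst (x 0 i : R) (0 : R) 1).
move=> h; apply: (is_derive_eq h).
by rewrite scaler0 add0r addr0 [_ *: 1]mulr1.
Qed.

Lemma sqnorm_delta (j : 'I_n) (h : R) (x : rV) :
  sqnorm (h *: delta_mx 0 j + x) = sqnorm x + 2 * x 0 j * h + h ^+ 2.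
Proof.
rewrite addrC sqnormD; congr (_ + _ + _).
  rewrite /dotp (bigD1 j)//= big1 ?addr0 => [|i ij]; last first.
    by rewrite !mxE eqxx/= (negbTE ij) !mulr0.
  by rewrite !mxE !eqxx mulr1; ring.
rewrite /sqnorm (bigD1 j)//= big1 ?addr0 => [|i ij]; last first.
  by rewrite !mxE eqxx/= (negbTE ij) mulr0 expr0n.
by rewrite !mxE !eqxx mulr1.
Qed.

Lemma is_derive_bubble (c : R) (j : 'I_n) (x : rV) :
  is_derive x (delta_mx 0 j) (bubble c) (- (2 * c) * (x 0 j * bubble (c + 1) x)).
Proof.
apply: is_derive_line.
(* Along a coordinate line the base of the power is a quadratic polynomial. *)
pose g (h : R) := 1 + sqnorm x + 2 * x 0 j * h + h ^+ 2.
rewrite (_ : (fun _ => _) = (fun t => t `^ (- c)) \o g); last first.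
  by apply/funext => h; rewrite /bubble sqnorm_delta /g /= !addrA.
have g0 : g 0 = 1 + sqnorm x by rewrite /g mulr0 expr0n /= !addr0.
have dg : is_derive (0 : R) 1 g (2 * x 0 j).
  have h1 := is_derive_id (0 : R) 1.
  have h2 := is_deriveD (is_deriveD (is_derive_cst (1 + sqnorm x) (0 : R) 1)
    (is_deriveM (is_derive_cst (2 * x 0 j) (0 : R) 1) h1)) (is_deriveM h1 h1).
  have -> : g = (fun h => 1 + sqnorm x + 2 * x 0 j * h + h * h).
    by apply/funext => h; rewrite /g expr2.
  apply: (is_derive_eq h2).
  by rewrite /GRing.scale/= !mulr0 !mul0r !addr0 add0r mulr1.
have dp : is_derive (g 0) 1 (fun t : R => t `^ (- c)) (- c * (g 0) `^ (- c - 1)).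
  by apply: is_derive1_powR; rewrite g0 sqnorm1_gt0.
have := is_derive1_comp dp dg.
move=> h; apply: (is_derive_eq h).
rewrite g0 /bubble (_ : - (c + 1) = - c - 1); ring.
Qed.

Lemma continuous_coord (i : 'I_n) : continuous (fun x : rV => x 0 i).
Proof. by move=> x; exact: coord_continuous. Qed.

Lemma continuous_sqnorm : continuous (@sqnorm R n).
Proof.
move=> x; rewrite /sqnorm; elim: (index_enum _) => [|i r IH].
  rewrite (_ : (fun _ => _) = fun=> 0); last by apply/funext => y; rewrite big_nil.
  exact: cst_continuous.
rewrite (_ : (fun _ => _) = fun y : rV => y 0 i * y 0 i + \sum_(j <- r) y 0 j ^+ 2).
  have c := @continuous_coord i x.
  exact: (cvgD (cvgM c c) IH).
by apply/funext => y; rewrite big_cons expr2.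
Qed.

Lemma continuous_bubble (c : R) : continuous (bubble c : rV -> R).
Proof.
move=> x; apply: (@continuous_comp _ _ _ (fun x : rV => 1 + sqnorm x) (fun t => t `^ (- c))).
  have h := @continuous_sqnorm x.
  have h1 := @cst_continuous rV R (1 : R) x.
  exact: (cvgD h1 h).
by apply: continuous_powR; exact: sqnorm1_gt0.
Qed.

(** Each derivative is again a combination of coordinates times bubbles of larger exponent, so two
    rounds of explicit formulas suffice. *)
Lemma Ck_bubble (c k : R) : Ck_open 2 setT (fun x : rV => k * bubble c x).
Proof.
have dM (i j : 'I_n) (e : R) (x : rV) :
    is_derive x (delta_mx 0 j) (fun y : rV => y 0 i * bubble e y)
      (x 0 i * (- (2 * e) * (x 0 j * bubble (e + 1) x)) + bubble e x * (i == j)%:R).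
  exact: (is_deriveM (is_derive_coord i j x) (is_derive_bubble e j x)).
have d1 (i : 'I_n) (x : rV) : is_derive x (delta_mx 0 i) (fun x : rV => k * bubble c x)
    (- (2 * c * k) * (x 0 i * bubble (c + 1) x)).
  apply: (is_derive_eq (is_deriveZ k (is_derive_bubble c i x))).
  by rewrite /GRing.scale/=; ring.
have p1 i : partial i (fun x : rV => k * bubble c x) =
    fun x => - (2 * c * k) * (x 0 i * bubble (c + 1) x).
  by apply/funext => x; rewrite /partial; case: (d1 i x).
have d2 (i j : 'I_n) (x : rV) :
    is_derive x (delta_mx 0 j) (fun x : rV => - (2 * c * k) * (x 0 i * bubble (c + 1) x))
    (- (2 * c * k) * (x 0 i * (- (2 * (c + 1)) * (x 0 j * bubble (c + 1 + 1) x)) +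
       bubble (c + 1) x * (i == j)%:R)).
  exact: (is_deriveZ _ (dM i j (c + 1) x)).
have p2 i j : partial j (fun x : rV => - (2 * c * k) * (x 0 i * bubble (c + 1) x)) =
    fun x => - (2 * c * k) * (x 0 i * (- (2 * (c + 1)) * (x 0 j * bubble (c + 1 + 1) x)) +
       bubble (c + 1) x * (i == j)%:R).
  by apply/funext => x; rewrite /partial; case: (d2 i j x).
have cc := continuous_coord; have cb := continuous_bubble.
split; first by move=> x _; exact: (cvgMl_tmp (cb c x)).
move=> i; split; first by move=> x _; case: (d1 i x).
rewrite p1; split.
  by move=> x _; exact: (cvgMl_tmp (cvgM (cc i x) (cb (c + 1) x))).
move=> j; split; first by move=> x _; case: (d2 i j x).
rewrite p2; split => // x _.
exact: (cvgMl_tmp (cvgD (cvgM (cc i x) (cvgMl_tmp (cvgM (cc j x) (cb (c + 1 + 1) x))))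
  (cvgMr_tmp (cb (c + 1) x)))).
Qed.

End bubble_smooth.

(** * The supersolution as a multiple of the bubble *)

Unset Implicit Arguments.

Theorem theorem1p4 (R : realType) (N : nat) (C s p q R0 : R)
    (hN : (1 <= N)%N) (hC : 0 < C)
    (hs : 1 / 2 < s < 1) (hNs : 2 * s < N%:R)
    (hp : N%:R / (N%:R - 2 * s) < p) (hq : 0 <= q) (hR0 : 0 < R0) :
  forall lambda : R, lambda <= 1 ->
  exists u : 'rV[R]_N -> R,
    [/\ classical_supersolution C s p q lambda (~` eball R0) u,
        forall x, 0 < u x &
        exists M : R, forall x, `|u x| <= M].
Proof.
move=> lambda lambda1.
have /andP[s12 s1] := hs.
have s0 : 0 < s by rewrite (lt_trans _ s12)// divr_gt0.
have d0 : 0 < N%:R - 2 * s by rewrite subr_gt0.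
(* The condition on [p] without denominators; it is equivalent to [s / (p - 1) < N / 2 - s]. *)
have p1s : 2 * s < (p - 1) * (N%:R - 2 * s).
  by move: hp; rewrite ltr_pdivrMr// => h; rewrite mulrBl mul1r ltrBrDr addrC subrK.
have p1 : 0 < p - 1 by rewrite -(pmulr_lgt0 _ d0) (lt_trans _ p1s)// mulr_gt0.
(* The solution of [b * p = b + s]: the [p]-th power of the bubble then decays exactly like the
   lower bound for its fractional Laplacian. *)
pose b := s / (p - 1).
have b0 : 0 < b by rewrite divr_gt0.
have sb : s < N%:R / 2 - b.
  by rewrite ltrBrDr -ltrBrDl ltr_pdivrMr//; lra.
(* The fractional Laplacian of [bubble b] is at least [c] times its [p]-th power. *)
pose c : R := C * (bubble_gain N s b / riesz_const N s).
have K0 := riesz_const_gt0 N s0.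
have c0 : 0 < c by rewrite mulr_gt0// divr_gt0// bubble_gain_gt0.
(* Balances the two homogeneities: [eta^p = eta * c]. *)
pose eta := c `^ (p - 1)^-1.
have eta0 : 0 < eta by rewrite powR_gt0.
have etap : eta `^ p = eta * c.
  have -> : eta * c = eta `^ 1 * eta `^ (p - 1).
    by rewrite powRr1 ?(ltW eta0)// /eta -powRrM mulVf ?gt_eqF// (powRr1 (ltW c0)).
  by rewrite -powRD ?(gt_eqF eta0) ?implybT//; congr (_ `^ _); ring.
have bubblep (x : 'rV[R]_N) : bubble b x `^ p = bubble (b + s) x.
  rewrite /bubble -powRrM; congr (_ `^ _); rewrite /b; field.
  by rewrite gt_eqF.
have u0 (x : 'rV[R]_N) : 0 < eta * bubble b x by rewrite mulr_gt0// bubble_gt0.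
have uM (x : 'rV[R]_N) : `|eta * bubble b x| <= eta.
  by rewrite ger0_norm ?(ltW (u0 x))// ler_piMr ?(ltW eta0)// bubble_le1// ltW.
exists (fun x => eta * bubble b x); split; [split|exact: u0|by exists eta].
- exists setT; split => //; first exact: openT.
  exact: Ck_bubble.
- split; first by apply: measurable_funM => //; exact: measurable_bubble.
  (* The bubble is at most 1, so the integrability of the weight alone is enough. *)
  apply: (@le_lt_trans _ _ (\int[lebesgue_rV R N]_x
      (eta * (1 / (1 + enorm x `^ (N%:R + 2 * s))))%:E)%E).
    have w0 (x : 'rV[R]_N) : 0 < 1 + enorm x `^ (N%:R + 2 * s).
      by rewrite ltr_wpDr ?powR_ge0.
    apply: ge0_le_integral => //.
    + by move=> x _; rewrite lee_fin divr_ge0// ltW.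
    + apply/measurable_EFinP; under eq_fun do rewrite -[X in X / _]mulr1 -mulrA.
      apply: measurable_funM; last exact: measurable_decay.
      by apply: measurableT_comp => //; apply: measurable_funM => //; exact: measurable_bubble.
    + apply/measurable_EFinP; apply: measurable_funM => //; exact: measurable_decay.
    + move=> x _; rewrite lee_fin mulrA mulr1 ler_wpM2r// invr_ge0 ltW//.
  rewrite ge0_integral_mull ?(ltW eta0)//.
  + by rewrite lte_mul_pinfty ?lee_fin ?(ltW eta0)// integral_decay_lty.
  + exact: measurable_decay.
  + by move=> x; rewrite divr_ge0// addr_ge0 ?powR_ge0.
- move=> x _; have cv := @frac_lap_trunc_bubble_cvg R N s b s0 s1 b0 x eta.
  split; first by apply/cvg_ex; eexists; exact: cv.
  rewrite /frac_lap (cvg_lim _ cv)//.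
  apply: (@le_trans _ _ (C * (eta * bubble_pv s b x))); last first.
    by rewrite lerDl powR_ge0.
  (* The power is nonnegative and [lambda <= 1], so the case [lambda = 1] implies the others. *)
  apply: (@le_trans _ _ ((eta * bubble b x) `^ p)).
    by rewrite ler_piMl ?powR_ge0.
  rewrite powRM ?(ltW eta0) ?bubble_ge0// etap bubblep.
  have h := bubble_pv_ge s0 s1 b0 x sb.
  rewrite -[leLHS]mulrA [leRHS]mulrCA ler_wpM2l ?(ltW eta0)// /c.
  rewrite -[leLHS]mulrA ler_wpM2l ?(ltW hC)// mulrAC ler_pdivrMr//.
  by rewrite [leRHS]mulrC.
Qed.
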